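(* The Boolean-to-free Bercovici–Pata bijection $\varphi\mapsto\psi$, where $\psi$ is determined by $\eta_\varphi(\mathbf{z})=R_\psi(\mathbf{z})$, takes the free / Boolean Meixner class to itself, and maps $$\varphi_{C,\{T_i\}}\mapsto\varphi_{I+C,\{T_i\}}.$$
   Context: $\mathbb{C}\langle x_1,\ldots,x_d\rangle$: polynomials in non-commuting self-adjoint variables; $x_{\vec u}=x_{u(1)}\cdots x_{u(n)}$ for a multi-index $\vec u\in\{1,\ldots,d\}^n$; $\mathbf{z}=(z_1,\ldots,z_d)$ non-commuting indeterminates. For a unital linear functional $\varphi$, the Boolean (resp. free) cumulant functional $\eta_\varphi$ (resp. $R_\varphi$) is defined by $\varphi[x_{\vec u}]=\sum_\pi\prod_{B\in\pi}\eta_\varphi[\prod_{i\in B}x_{u(i)}]$ over interval partitions (resp. the same with $R_\varphi$ over non-crossing partitions) of $\{1,\ldots,|\vec u|\}$, and $\eta_\varphi(\mathbf{z})=\sum_{|\vec u|\ge1}\eta_\varphi[x_{\vec u}]z_{\vec u}$, $R_\varphi(\mathbf{z})=\sum_{|\vec u|\ge1}R_\varphi[x_{\vec u}]z_{\vec u}$. Free (equivalently, Boolean) Meixner states: let $T_1,\ldots,T_d$ be Hermitian $d\times d$ matrices and $C$ a diagonal $d^2\times d^2$ matrix, $C(e_i\otimes e_j)=C_{ij}e_i\otimes e_j$, with $I+C\ge0$ and $(T_i\otimes I)C=C(T_i\otimes I)$. The free Meixner state $\varphi_{C,\{T_i\}}$ is the unital functional (which is a state with zero means and identity covariance) determined by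 $\varphi[P_{\vec u}]=0$ for $\vec u\ne\emptyset$, where $P_\emptyset=1$, $x_i=P_i$, $x_iP_j=P_{(i,j)}+\sum_k(T_i)_{kj}P_k+\delta_{ij}$, and $x_iP_{(j,\vec u)}=P_{(i,j,\vec u)}+\sum_k(T_i)_{kj}P_{(k,\vec u)}+\delta_{ij}(1+C_{i,u(1)})P_{\vec u}$ for $|\vec u|\ge1$. Free Meixner states are exactly the states $\varphi_{C,\{T_i\}}$. *)

(* Defs.v *)
From HB Require Import structures.
From mathcomp Require Import all_boot all_order all_algebra finmap.
From mathcomp Require Import sesquilinear spectral.
From mathcomp Require Import boolp reals.
From mathcomp.multinomials Require Import monalg.
From mathcomp Require Import complex mxtens.

Set Implicit Arguments.
Unset Strict Implicit.
Unset Printing Implicit Defensive.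

Import Order.TTheory GRing.Theory Num.Theory.
Local Open Scope ring_scope.
Local Open Scope sesquilinear_scope.

(* K<x_1, ..., x_d>: the monoid algebra of the free monoid on d letters. *)
Notation ncpoly K d := {malg K[{fmonom 'I_d}]}.

Section Partitions.

Definition interval_partitions (n : nat) : {set {set {set 'I_n}}} :=
  [set pi | partition pi [set: 'I_n] &
    [forall B in pi, forall i in B, forall k in B, forall j : 'I_n,
      (i <= j <= k)%N ==> (j \in B)]].

Definition noncrossing_partitions (n : nat) : {set {set {set 'I_n}}} :=
  [set pi | partition pi [set: 'I_n] &
    [forall B in pi, forall B' in pi,
      forall i in B, forall k in B, forall j in B', forall l in B',
      (i < j)%N && (j < k)%N && (k < l)%N ==> (B == B')]].

Definition good_partitions (Q : forall n, {set {set {set 'I_n}}}) : Prop :=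
  forall n, (forall pi, pi \in Q n -> partition pi [set: 'I_n]) /\
    ((0 < n)%N -> [set [set: 'I_n]] \in Q n).

Lemma partition1 n : (0 < n)%N -> partition [set [set: 'I_n]] [set: 'I_n].
Proof.
move=> n0; rewrite /partition cover1 eqxx trivIset1 inE eq_sym /=.
by apply/set0Pn; exists (Ordinal n0).
Qed.

Lemma good_interval_partitions : good_partitions interval_partitions.
Proof.
move=> n; split=> [pi|n0]; first by rewrite inE => /andP[].
rewrite inE partition1 //=.
apply/forall_inP => B /set1P->; apply/forall_inP => i _.
by apply/forall_inP => k _; apply/forallP => j; rewrite inE implybT.
Qed.

Lemma good_noncrossing_partitions : good_partitions noncrossing_partitions.
Proof.
move=> n; split=> [pi|n0]; first by rewrite inE => /andP[].
rewrite inE partition1 //=.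
apply/forall_inP => B /set1P->; apply/forall_inP => B' /set1P->.
do 4!(apply/forall_inP => ? _).
by rewrite eqxx implybT.
Qed.

Lemma block_small n (pi : {set {set 'I_n}}) (B : {set 'I_n}) :
  partition pi [set: 'I_n] -> pi != [set [set: 'I_n]] -> B \in pi ->
  (0 < #|B| < n)%N.
Proof.
case/and3P=> /eqP cov triv n0 ne BP; rewrite card_gt0.
have B0 (A : {set 'I_n}) : A \in pi -> A != set0.
  by move=> AP; apply: contraNneq n0 => <-.
rewrite B0 //= -[X in (_ < X)%N]card_ord -cardsT proper_card // properEneq subsetT andbT.
apply: contraNneq ne => BT; apply/eqP/setP => A; rewrite inE -BT.
apply/idP/eqP => [AP|-> //]; have [//|nAB] := eqVneq A B.
have := trivIsetP triv _ _ AP BP nAB.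
by rewrite BT -setI_eq0 setIT (negPf (B0 _ AP)).
Qed.

End Partitions.

Section NCPoly.
Variables (K : numClosedFieldType) (d : nat).
Local Notation A := (ncpoly K d).
Implicit Types (u : seq 'I_d) (p : A) (phi psi : {scalar A}).

Definition xword u : A := << FMonom u >>.

(* The variables are self-adjoint: the involution conjugates the coefficients
   and reverses the words. *)
Definition ncstar p : A :=
  \sum_(m <- msupp p) << (p@_m)^* *g FMonom (rev m) >>.

Definition is_state phi : Prop :=
  phi 1 = 1 /\ forall p, 0 <= phi (ncstar p * p).

(* The restriction of u to the positions in B, in increasing order. *)
Definition subword u (B : {set 'I_(size u)}) : seq 'I_d :=
  [seq tnth (in_tuple u) i | i in B].

(* The moment-cumulant relation over the partitions Q, solved for the term of
   the one-block partition; the fuel n bounds the length of u.  The relation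
   itself is moment_cumulant below. *)
Fixpoint cumulant_rec (Q : forall n, {set {set {set 'I_n}}}) phi
    (n : nat) (u : seq 'I_d) : K :=
  if n is n'.+1 then
    phi (xword u) -
      \sum_(pi in Q (size u) | pi != [set [set: 'I_(size u)]])
        \prod_(B in pi) cumulant_rec Q phi n' (subword B)
  else 0.

Definition cumulant Q phi u : K := cumulant_rec Q phi (size u) u.

(* eta_phi[x_u] and R_phi[x_u]; as functions of the nonempty word u these are
   the coefficients of the series eta_phi(z) and R_phi(z). *)
Definition boolean_cumulant := cumulant interval_partitions.
Definition free_cumulant := cumulant noncrossing_partitions.

Lemma size_subword u (B : {set 'I_(size u)}) : size (subword B) = #|B|.
Proof. by rewrite size_map -cardE. Qed.

Lemma subwordT u : subword [set: 'I_(size u)] = u.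
Proof.
rewrite /subword /image_mem.
have -> : enum [set: 'I_(size u)] = enum 'I_(size u).
  by apply: eq_enum => i; rewrite !inE.
exact: (map_tnth_enum (in_tuple u)).
Qed.

Lemma cumulant_recE Q phi n u : good_partitions Q -> (size u <= n)%N ->
  u != [::] -> cumulant_rec Q phi n u = cumulant Q phi u.
Proof.
move=> gQ; suff rec_eq m v : (size v <= n)%N -> (size v <= m)%N -> v != [::] ->
    cumulant_rec Q phi n v = cumulant_rec Q phi m v.
  by move=> un; apply: rec_eq.
elim: n m v => [|n IH] [|m] v; rewrite ?leqn0 ?size_eq0; do ?by case: eqP.
move=> vn vm v0 /=; congr (_ - _); apply: eq_bigr => pi /andP[piQ ne].
apply: eq_bigr => B BP.
have /andP[B0 Bn] := block_small ((gQ _).1 _ piQ) ne BP.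
apply: IH; rewrite ?size_subword -?size_eq0 ?size_subword -?lt0n //.
  by rewrite -ltnS (leq_trans Bn).
by rewrite -ltnS (leq_trans Bn).
Qed.

Lemma cumulantE Q phi u : good_partitions Q -> u != [::] ->
  cumulant Q phi u = phi (xword u) -
      \sum_(pi in Q (size u) | pi != [set [set: 'I_(size u)]])
        \prod_(B in pi) cumulant Q phi (subword B).
Proof.
move=> gQ u0; rewrite -(@cumulant_recE Q phi (size u).+1) //=.
congr (_ - _); apply: eq_bigr => pi /andP[piQ ne]; apply: eq_bigr => B BP.
have /andP[B0 Bn] := block_small ((gQ _).1 _ piQ) ne BP.
by rewrite cumulant_recE // ?size_subword 1?ltnW // -size_eq0 size_subword -lt0n.
Qed.

Lemma moment_cumulant Q phi u : good_partitions Q -> u != [::] ->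
  phi (xword u) =
    \sum_(pi in Q (size u)) \prod_(B in pi) cumulant Q phi (subword B).
Proof.
move=> gQ u0.
rewrite (bigD1 [set [set: 'I_(size u)]]) /=; last first.
  by apply: (gQ _).2; rewrite lt0n size_eq0.
by rewrite big_set1 subwordT cumulantE // subrK.
Qed.

Lemma cumulant_unique Q phi (k : seq 'I_d -> K) : good_partitions Q ->
  (forall u, u != [::] ->
    phi (xword u) = \sum_(pi in Q (size u)) \prod_(B in pi) k (subword B)) ->
  forall u, u != [::] -> k u = cumulant Q phi u.
Proof.
move=> gQ H u; have [n] := ubnP (size u); elim: n u => // n IH u un u0.
rewrite cumulantE // H // (bigD1 [set [set: 'I_(size u)]]) /=; last first.
  by apply: (gQ _).2; rewrite lt0n size_eq0.
rewrite big_set1 subwordT [X in _ = _ + X - _](_ : _ = \sum_(pi in Q (size u) | pi != [set [set: 'I_(size u)]])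
        \prod_(B in pi) cumulant Q phi (subword B)) ?addrK //.
apply: eq_bigr => pi /andP[piQ ne]; apply: eq_bigr => B BP.
have /andP[B0 Bn] := block_small ((gQ _).1 _ piQ) ne BP.
by apply: IH; rewrite ?size_subword -?size_eq0 ?size_subword -?lt0n // (leq_trans Bn).
Qed.

Section LinearExtension.
Variables (V : lmodType K) (f : {fmonom 'I_d} -> V).

Definition linext p : V := \sum_(m <- msupp p) p@_m *: f m.

Lemma linextEw (D : {fset {fmonom 'I_d}}) p : (msupp p `<=` D)%fset ->
  linext p = \sum_(m <- D) p@_m *: f m.
Proof.
move=> le; apply/big_fset_incl => // k _ /mcoeff_outdom ->.
by rewrite scale0r.
Qed.

Lemma linext_is_linear : linear linext.
Proof.
move=> c p q.
rewrite (linextEw (D := (msupp p `|` msupp q `|` msupp (c *: p + q))%fset)) ?fsubsetUr //.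
rewrite (linextEw (p := p) (D := (msupp p `|` msupp q `|` msupp (c *: p + q))%fset)); last first.
  by rewrite -fsetUA fsubsetUl.
rewrite (linextEw (p := q) (D := (msupp p `|` msupp q `|` msupp (c *: p + q))%fset)); last first.
  by rewrite fsubsetU // fsubsetUr.
rewrite scaler_sumr -big_split /=; apply: eq_bigr => m _.
by rewrite mcoeffD mcoeffZ scalerDl scalerA.
Qed.

HB.instance Definition _ := GRing.isLinear.Build K A V *:%R linext
  linext_is_linear.

Lemma linextU m : linext << m >> = f m.
Proof. by rewrite /linext msuppU1 big_seq_fset1 mcoeffUU scale1r. Qed.

End LinearExtension.

Definition scalext (f : {fmonom 'I_d} -> K) p : K := linext (f : _ -> K^o) p.

Lemma scalext_is_linear f : scalar (scalext f).
Proof. by move=> c p q; rewrite /scalext linearP. Qed.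

HB.instance Definition _ f := GRing.isLinear.Build K A K *%R (scalext f)
  (scalext_is_linear f).

Lemma scalextU f m : scalext f << m >> = f m.
Proof. by rewrite /scalext linextU. Qed.

Lemma ncpolyE p : p = \sum_(m <- msupp p) p@_m *: xword m.
Proof.
rewrite {1}[p]monalgE; apply: eq_bigr => m _.
apply/malgP => k; rewrite mcoeffZ !mcoeffU /= fmK.
by rewrite mulrnAr mulr1.
Qed.

Lemma linear_wordE (f : {linear A -> A}) p :
  f p = \sum_(m <- msupp p) p@_m *: f (xword m).
Proof.
by rewrite {1}[p]ncpolyE linear_sum; apply: eq_bigr => m _; rewrite linearZ.
Qed.

Lemma linear_combE (f : {linear A -> A}) n (a : 'I_n -> K) (g : 'I_n -> A)
    (c : K) (p q : A) :
  f (p + \sum_(k < n) a k *: g k + c *: q)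
  = f p + \sum_(k < n) a k *: f (g k) + c *: f q.
Proof.
rewrite !linearD linear_sum linearZ; congr (_ + _ + _).
by apply: eq_bigr => k _; rewrite linearZ.
Qed.

Lemma linear_famE (f : {linear A -> A}) (r : seq {fmonom 'I_d})
    (a : {fmonom 'I_d} -> K) (g : {fmonom 'I_d} -> A) :
  f (\sum_(m <- r) a m *: g m) = \sum_(m <- r) a m *: f (g m).
Proof.
by rewrite linear_sum; apply: eq_bigr => k _; rewrite linearZ.
Qed.

Lemma scalar_ext phi psi :
  (forall u, phi (xword u) = psi (xword u)) -> phi =1 psi.
Proof.
move=> e p; rewrite [p]ncpolyE !linear_sum /=; apply: eq_bigr => m _.
by rewrite !linearZ /= e.
Qed.

Lemma xword0 : xword [::] = 1.
Proof. by rewrite /xword -fmoneE. Qed.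

Lemma exists_boolean_to_free phi : exists psi : {scalar A},
  psi 1 = 1 /\ forall u, u != [::] -> boolean_cumulant phi u = free_cumulant psi u.
Proof.
pose mom (m : {fmonom 'I_d}) : K := if fmonom_val m == [::] then 1 else
  \sum_(pi in noncrossing_partitions (size m))
    \prod_(B in pi) boolean_cumulant phi (subword B).
have momU u : scalext mom (xword u) = mom (FMonom u).
  by rewrite /xword scalextU.
exists (scalext mom : {scalar A}); split.
  by rewrite -xword0 [LHS]momU.
apply: (cumulant_unique good_noncrossing_partitions) => u u0.
by rewrite [LHS]momU /mom /= (negPf u0).
Qed.

(* The Boolean-to-free Bercovici-Pata bijection: the unital functional psi with
   R_psi(z) = eta_phi(z). *)
Definition boolean_to_free phi : {scalar A} :=
  projT1 (cid (exists_boolean_to_free phi)).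

Lemma boolean_to_freeP phi psi :
  (psi 1 = 1 /\
   forall u, u != [::] -> boolean_cumulant phi u = free_cumulant psi u) <->
  psi =1 boolean_to_free phi.
Proof.
rewrite /boolean_to_free; case: cid => chi [/= chi1 chiR].
split=> [[psi1 psiR]|e].
  apply: scalar_ext => u; have [->|u0] := eqVneq u [::].
    by rewrite xword0 psi1 chi1.
  rewrite !(moment_cumulant _ good_noncrossing_partitions) //.
  apply: eq_bigr => pi piQ; apply: eq_bigr => B BP.
  have B0 : subword B != [::].
    have /and3P[_ _ n0] := (good_noncrossing_partitions _).1 _ piQ.
    rewrite -size_eq0 size_subword cards_eq0.
    by apply: contraNneq n0 => <-.
  by rewrite -[LHS]psiR // -[RHS]chiR.
split=> [|u u0]; first by rewrite e.
rewrite chiR //; apply: (cumulant_unique good_noncrossing_partitions) => // v v0.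
by rewrite e (moment_cumulant _ good_noncrossing_partitions).
Qed.

Section Meixner.
Variables (C : 'M[K]_(d * d)) (T : 'I_d -> 'M[K]_d).

(* C_{ij}, where C (e_i (x) e_j) = C_{ij} e_i (x) e_j *)
Definition diag_entry (i j : 'I_d) : K :=
  C (mxtens_index (i, j)) (mxtens_index (i, j)).

Definition meixner_weight (i : 'I_d) u : K :=
  if u is a :: _ then 1 + diag_entry i a else 1.

(* meixner_poly_cons u i = P_{(i, u)}; the recursion is the one recorded in
   meixner_poly1 and meixner_poly_rec. *)
Fixpoint meixner_poly_cons u : 'I_d -> A :=
  if u is j :: u' then fun i =>
    xword [:: i] * meixner_poly_cons u' j
    - \sum_(k < d) T i k j *: meixner_poly_cons u' k
    - ((i == j)%:R * meixner_weight i u') *: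
        (if u' is a :: u'' then meixner_poly_cons u'' a else 1)
  else fun i => xword [:: i].

Definition meixner_poly u : A :=
  if u is i :: u' then meixner_poly_cons u' i else 1.

Lemma meixner_poly0 : meixner_poly [::] = 1. Proof. by []. Qed.

Lemma meixner_poly1 i : xword [:: i] = meixner_poly [:: i].
Proof. by []. Qed.

Lemma meixner_poly_rec i j u :
  xword [:: i] * meixner_poly (j :: u) =
    meixner_poly (i :: j :: u) + \sum_(k < d) T i k j *: meixner_poly (k :: u)
    + ((i == j)%:R * meixner_weight i u) *: meixner_poly u.
Proof. by apply/eqP; rewrite -2!subr_eq addrAC; apply/eqP. Qed.

Let mulxword i u : xword [:: i] * xword u = xword (i :: u).
Proof.
rewrite /xword malgM_def fgmulUU mulr1; congr << _ >>.
exact: fmmulE.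
Qed.

Let scaleAr c p q : c *: (p * q) = p * (c *: q).
Proof.
have -> : c *: q = c%:MP * q by rewrite mul_malgC.
rewrite scalerAl mulrA; congr (_ * _).
rewrite [RHS]malgM_def fgmulgU malgZ_def /fgscale; apply: eq_bigr => k _.
by rewrite monalg.mulm1 mulrC.
Qed.

Let mulxwordE i p :
  xword [:: i] * p = \sum_(m <- msupp p) p@_m *: xword (i :: m).
Proof.
rewrite {1}[p]ncpolyE mulr_sumr; apply: eq_bigr => m _.
by rewrite -scaleAr mulxword.
Qed.

(* In the model where the word u stands for P_u, the variable x_i acts by op i;
   rep p is p applied to the empty word. *)
Lemma meixner_basis : exists rep frombasis : {linear A -> A},
  [/\ forall u, rep (meixner_poly u) = xword u,
      forall u, frombasis (xword u) = meixner_poly u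
    & forall p, frombasis (rep p) = p].
Proof.
have [op op1 opE] : exists2 op : 'I_d -> {linear A -> A},
    forall i, op i (xword [::]) = xword [:: i] &
    forall i j u, op i (xword (j :: u)) =
      xword (i :: j :: u) + \sum_(k < d) T i k j *: xword (k :: u)
      + ((i == j)%:R * meixner_weight i u) *: xword u.
  exists (fun i => linext (fun m : {fmonom 'I_d} =>
    if fmonom_val m is j :: u then
      xword (i :: j :: u) + \sum_(k < d) T i k j *: xword (k :: u)
      + ((i == j)%:R * meixner_weight i u) *: xword u
    else xword [:: i])) => *; exact: linextU.
have [rep repE] : exists rep : {linear A -> A},
    forall u, rep (xword u) = foldr (fun i => op i) (xword [::]) u.
  exists (linext (fun m : {fmonom 'I_d} =>
    foldr (fun i => op i) (xword [::]) (fmonom_val m))) => u; exact: linextU.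
have [frombasis fbE] : exists frombasis : {linear A -> A},
    forall u, frombasis (xword u) = meixner_poly u.
  exists (linext (fun m : {fmonom 'I_d} => meixner_poly (fmonom_val m))) => u.
  exact: linextU.
have repM i p : rep (xword [:: i] * p) = op i (rep p).
  rewrite mulxwordE (linear_wordE rep p) !linear_famE.
  by apply: eq_bigr => m _; rewrite !repE.
exists rep, frombasis; split=> // [u|p].
  have [n] := ubnP (size u); elim: n u => // n IH [|i [|j u]] sn.
  - by rewrite meixner_poly0 -xword0 repE.
  - by rewrite -meixner_poly1 repE -op1.
  have := congr1 rep (meixner_poly_rec i j u).
  rewrite repM IH // opE linear_combE (IH u); last by rewrite -ltnS ltnW.
  under [X in _ = _ + X + _]eq_bigr => k _ do rewrite IH //.
  by move/addIr/addIr.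
rewrite (linear_wordE rep p) linear_famE [RHS]ncpolyE.
apply: eq_bigr => m _; rewrite repE; congr (_ *: _).
elim: (fmonom_val m) => [|i u IH] //=; first by rewrite fbE xword0.
rewrite -mulxword -{}IH; move: (foldr _ _ _) => q.
rewrite (linear_wordE (op i) q) (linear_wordE frombasis q) linear_famE mulr_sumr.
apply: eq_bigr => m' _; rewrite -scaleAr; congr (_ *: _).
case: (fmonom_val m') => [|j v].
  by rewrite op1 [LHS]fbE [X in _ * X]fbE meixner_poly0 mulr1 meixner_poly1.
rewrite opE linear_combE [X in _ = _ * X]fbE [RHS]meixner_poly_rec.
rewrite [X in X + _ + _ = _]fbE [X in _ + _ *: X = _]fbE.
by under [X in _ + X + _ = _]eq_bigr => k _ do rewrite [X in _ *: X]fbE.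
Qed.

Lemma exists_free_meixner_functional : exists phi : {scalar A},
  phi 1 = 1 /\ forall u, u != [::] -> phi (meixner_poly u) = 0.
Proof.
have [rep [_ [repP _ _]]] := meixner_basis.
have [phi phiE] : exists phi : {scalar A}, forall p, phi p = mcoeff (FMonom [::]) (rep p : A).
  exists (scalext (fun m : {fmonom 'I_d} => mcoeff (FMonom [::]) (rep (xword (fmonom_val m)) : A))).
  move=> p; rewrite (linear_wordE rep p) raddf_sum; apply: eq_bigr => m _.
  by rewrite [RHS]mcoeffZ.
have one u : mcoeff (FMonom [::]) (xword u) = (u == [::])%:R :> K.
  by rewrite mcoeffU1 -val_eqE.
exists phi; split=> [|u u0]; rewrite phiE.
  by rewrite -meixner_poly0 repP one.
by rewrite repP one (negPf u0).
Qed.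

(* phi_{C, {T_i}}: the unital functional with phi[P_u] = 0 for u nonempty *)
Definition free_meixner_functional : {scalar A} :=
  projT1 (cid exists_free_meixner_functional).

Lemma free_meixner_functionalP phi :
  (phi 1 = 1 /\ forall u, u != [::] -> phi (meixner_poly u) = 0) <->
  phi =1 free_meixner_functional.
Proof.
rewrite /free_meixner_functional; case: cid => psi [/= psi1 psi0].
split=> [[phi1 phi0] p|e].
  have [rep [frombasis [_ fbE fbK]]] := meixner_basis.
  rewrite -(fbK p) (linear_wordE frombasis) !linear_sum /=.
  apply: eq_bigr => m _; rewrite !linearZ /= fbE; congr (_ * _).
  case: m => -[|i u]; first by rewrite meixner_poly0 phi1 psi1.
  by rewrite (phi0 (i :: u)) // (psi0 (i :: u)).
by split=> [|u u0]; rewrite e ?psi1 ?psi0.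
Qed.

Definition psdmx n (M : 'M[K]_n) : Prop :=
  M \is hermsymmx /\ forall v : 'cV[K]_n, 0 <= (v ^t* *m M *m v) 0 0.

Definition meixner_data : Prop :=
  [/\ forall i, T i \is hermsymmx,
      is_diag_mx C,
      psdmx (1%:M + C) &
      forall i, (T i *t (1%:M : 'M[K]_d)) *m C = C *m (T i *t 1%:M)].

End Meixner.

Definition free_meixner_state phi : Prop :=
  is_state phi /\
  exists C T, meixner_data C T /\ phi =1 free_meixner_functional C T.

End NCPoly.

(* Main.v *)
Require Import Defs.
From HB Require Import structures.
From mathcomp Require Import all_boot all_order all_algebra finmap.
From mathcomp Require Import sesquilinear.
From mathcomp Require Import boolp functions reals.
From mathcomp.multinomials Require Import monalg.
From mathcomp Require Import complex mxtens ring.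

Set Implicit Arguments.
Unset Strict Implicit.
Unset Printing Implicit Defensive.

Import Order.TTheory GRing.Theory Num.Theory.
Local Open Scope ring_scope.

(** Write C_ij for [diag_entry C i j], and let D_i be the operator that removes
a first letter i from the words of a noncommutative power series and kills the
other words ([sder]).  A functional is the series M of its moments.

The recursion of the polynomials P_u says that x_j acts on them by creating a
letter j, by applying T_j to the first letter, or by annihilating a first
letter j, with weight 1 + C_ji if a letter i follows it and weight 1 otherwise.
Hence M counts weighted lattice paths that start and end at the empty word.  If
E_i is the series of the paths from the empty word to the word i that do not
return to the empty word, then cutting a path at its last passage through a
level gives
-   D_i M = E_i M,
-   D_j E_i = delta_ij + sum_k (T_j)_ik E_k + (1 + C_ji) E_j E_i
([meixner_moments], [sder_paths]); the second equation determines the E_i.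

Cutting an interval partition after the block of the first letter shows that
the first equation reads D_i eta = E_i ([boolean_cumulant_eq]).  The analogous
decomposition of non-crossing partitions says that a series R consists of the
free cumulants of a functional with moment series N as soon as
-   D_i N = (D_i R)(N z) N,
where f(N z) is f with N z_b substituted for every letter z_b
([free_cumulant_eq]).

Let N be the moment series for I + C and E' its family of paths, and take
R = eta.  Put H_i = E_i(N z).  Substitution is an algebra homomorphism
([ssubstM]), so the quadratic equation for E passes to H; but removing a first
letter j from H_i may also remove it from the factor N that the substitution
puts in front of the first letter of E_i, which adds the term (D_j N) N^-1 H_i = E'_j H_i:
-   D_j H_i = delta_ij + sum_k (T_j)_ik H_k + (1 + C_ji) H_j H_i + E'_j H_i.
The family E' solves this system, because its own weights are 1 + (1 + C_ji).
Therefore H = E' ([ssubst_paths]), that is D_i N = (D_i eta)(N z) N, and N is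
the moment series of the image of phi_C.

It remains to see that the image is a state.  The P_u are orthogonal with
squared norms that are products of the numbers 1 + C_ij ([meixner_orthogonal]):
multiplication by x_i is symmetric for this form because T_i is Hermitian and
its tensor product with the identity commutes with C.  These numbers are the
diagonal entries of the positive matrix I + C.  Since the image has data I + C
and T_i, and I + (I + C) is positive too, this applies to it. *)

(** * Noncommutative power series *)

(** A series is the family of its coefficients, indexed by words.  The alias
carries the convolution product; on plain functions it would compete with the
pointwise one. *)
Definition ncseries (K : comNzRingType) (I : Type) := seq I -> K.

HB.instance Definition _ (K : comNzRingType) (I : Type) :=
  GRing.Lmodule.copy (ncseries K I) (seq I -> K^o).

Section NCSeries.
Variables (K : comNzRingType) (I : Type).
Local Notation S := (ncseries K I).
Implicit Types (f g h : S) (u v : seq I) (a c : K).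

Lemma seriesDE f g u : (f + g) u = f u + g u. Proof. by []. Qed.
Lemma seriesZE c f u : (c *: f) u = c * f u. Proof. by []. Qed.
Lemma series_sumE (J : Type) (r : seq J) (F : J -> S) u :
  (\sum_(j <- r) F j) u = \sum_(j <- r) F j u.
Proof. by elim/big_ind2: _ => // f ? g ? <- <-. Qed.

Definition sder (i : I) f : S := fun u => f (i :: u).

Lemma sder_is_linear i : linear (sder i). Proof. by []. Qed.
HB.instance Definition _ i :=
  GRing.isLinear.Build K S S *:%R (sder i) (sder_is_linear i).

(** The product, with its coefficients computed by the Leibniz rule
D_i (f g) = (D_i f) g + f[1] D_i g instead of a sum over the cuts of a word. *)
Fixpoint sconv_rec f g u : K :=
  if u is i :: u' then f [::] * g u + sconv_rec (sder i f) g u'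
  else f [::] * g [::].

Definition sconv f g : S := sconv_rec f g.

Lemma sconv_cons f g i u :
  sconv f g (i :: u) = f [::] * g (i :: u) + sconv (sder i f) g u.
Proof. by []. Qed.

Lemma sconv_nil f g : sconv f g [::] = f [::] * g [::]. Proof. by []. Qed.

Definition sone : S := fun u => (nilp u)%:R.

Lemma sconvDl : left_distributive sconv +%R.
Proof.
move=> f1 f2 g; apply/funext => u; rewrite seriesDE.
elim: u f1 f2 => [|i u IH] f1 f2; first exact: mulrDl.
by rewrite !sconv_cons linearD IH seriesDE mulrDl addrACA.
Qed.

Lemma sconvDr : right_distributive sconv +%R.
Proof.
move=> f g1 g2; apply/funext => u; rewrite seriesDE.
elim: u f => [|i u IH] f; first exact: mulrDr.
by rewrite !sconv_cons IH seriesDE mulrDr addrACA.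
Qed.

Lemma sconvZl c f g : sconv (c *: f) g = c *: sconv f g.
Proof.
apply/funext => u; rewrite seriesZE.
elim: u f => [|i u IH] f; first by rewrite sconv_nil mulrA.
by rewrite !sconv_cons linearZ IH mulrDr mulrA.
Qed.

Lemma sconvZr c f g : sconv f (c *: g) = c *: sconv f g.
Proof.
apply/funext => u; rewrite seriesZE.
elim: u f => [|i u IH] f; first by rewrite !sconv_nil mulrCA.
by rewrite !sconv_cons IH mulrDr mulrCA.
Qed.

Lemma sconv0l f : sconv 0 f = 0.
Proof. by rewrite -[X in sconv X _](scale0r (0 : S)) sconvZl scale0r. Qed.

Lemma sconv1l : left_id sone sconv.
Proof.
move=> f; apply/funext => -[|i u]; first by rewrite sconv_nil mul1r.
by rewrite sconv_cons mul1r (_ : sder i sone = 0) // sconv0l addr0.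
Qed.

Lemma sconv1r : right_id sone sconv.
Proof.
move=> f; apply/funext => u.
elim: u f => [|i u IH] f; first by rewrite sconv_nil mulr1.
by rewrite sconv_cons mulr0 add0r IH.
Qed.

Lemma sder_conv i f g :
  sder i (sconv f g) = sconv (sder i f) g + f [::] *: sder i g.
Proof. by apply/funext => u; rewrite seriesDE addrC. Qed.

Lemma sconvA : associative sconv.
Proof.
move=> f g h; apply/funext => u.
elim: u f g => [|i u IH] f g; first by rewrite !sconv_nil mulrA.
rewrite !sconv_cons sder_conv sconvDl sconvZl seriesDE seriesZE IH.
rewrite mulrDr -addrA mulrA.
by congr (_ + _); rewrite addrC.
Qed.

Lemma sone_neq0 : sone != 0.
Proof.
by apply/eqP => /(congr1 (fun f : S => f [::]))/eqP; rewrite oner_eq0.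
Qed.

HB.instance Definition _ := GRing.Zmodule_isNzRing.Build S
  sconvA sconv1l sconv1r sconvDl sconvDr sone_neq0.

HB.instance Definition _ := GRing.Lmodule_isLalgebra.Build K S
  (fun c f g => esym (sconvZl c f g)).

HB.instance Definition _ := GRing.Lalgebra_isAlgebra.Build K S
  (fun c f g => esym (sconvZr c f g)).

Lemma seriesM0 f g : (f * g) [::] = f [::] * g [::]. Proof. by []. Qed.
Lemma seriesMS f g i u :
  (f * g) (i :: u) = f [::] * g (i :: u) + (sder i f * g) u.
Proof. by []. Qed.
Lemma sderM i f g : sder i (f * g) = sder i f * g + f [::] *: sder i g.
Proof. exact: sder_conv. Qed.
Lemma sderD i f g : sder i (f + g) = sder i f + sder i g.
Proof. by []. Qed.
Lemma sderZ i c f : sder i (c *: f) = c *: sder i f. Proof. by []. Qed.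
Lemma sder1 i : sder i 1 = 0. Proof. by []. Qed.

(** A coefficient of a product only involves coefficients at words that are not
longer; this is what makes the inductions on the length of words work. *)
Lemma eq_seriesM f f' g g' u :
  (forall v, (size v <= size u)%N -> f v = f' v) ->
  (forall v, (size v <= size u)%N -> g v = g' v) -> (f * g) u = (f' * g') u.
Proof.
rewrite /GRing.mul /=.
elim: u f f' => [|i u IH] f f' ef eg; first by rewrite !sconv_nil ef // eg.
rewrite !sconv_cons ef // eg // (IH (sder i f) (sder i f')) // => v vu.
  exact: ef.
exact/eg/leqW.
Qed.

Lemma seriesP f g :
  f [::] = g [::] -> (forall i, sder i f = sder i g) -> f = g.
Proof.
by move=> e0 eS; apply/funext => -[//|i u]; rewrite -!/(sder i _ u) eS.
Qed.

End NCSeries.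

(** * Substitution of M z_i for z_i *)

Section Substitution.
Variables (K : comNzRingType) (I : Type) (M : ncseries K I).
Local Notation S := (ncseries K I).
Implicit Types (f g h : S).

(** The result f(M z) of the substitution satisfies f(M z) = f[1] + M t(f) with
D_i t(f) = (D_i f)(M z).  As M multiplies t(f) from the left, the structural
recursion on words computes h t(f) for all left factors h at once; see
[ssubst_recE]. *)
Fixpoint ssubst_rec_fun (h f : S) u : K :=
  if u is i :: u' then
    ssubst_rec_fun (sder i h) f u' +
      h [::] * (f [:: i] * (nilp u')%:R + ssubst_rec_fun M (sder i f) u')
  else 0.

Definition ssubst_rec h f : S := ssubst_rec_fun h f.

Lemma ssubst_rec_cons h f i u : ssubst_rec h f (i :: u) =
  ssubst_rec (sder i h) f u +
    h [::] * (f [:: i] * (nilp u)%:R + ssubst_rec M (sder i f) u).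
Proof. by []. Qed.

Definition ssubst_tail f : S := ssubst_rec 1 f.
Definition ssubst f : S := (f [::])%:A + M * ssubst_tail f.

Lemma ssubst_rec0 f u : ssubst_rec 0 f u = 0.
Proof.
by elim: u => // i u IH; rewrite ssubst_rec_cons linear0 IH mul0r addr0.
Qed.

Lemma ssubst_tail0 f : ssubst_tail f [::] = 0. Proof. by []. Qed.

Lemma ssubst_recE h f : ssubst_rec h f = h * ssubst_tail f.
Proof.
apply/funext => u; elim: u h => [|i u IH] h; first by rewrite seriesM0 mulr0.
rewrite seriesMS ssubst_rec_cons IH addrC; congr (_ * _ + _).
by rewrite /ssubst_tail ssubst_rec_cons sder1 ssubst_rec0 add0r mul1r.
Qed.

Lemma sder_ssubst_tail i f : sder i (ssubst_tail f) = ssubst (sder i f).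
Proof.
apply/funext => u; rewrite /ssubst seriesDE seriesZE -ssubst_recE.
by rewrite {1}/sder /ssubst_tail ssubst_rec_cons sder1 ssubst_rec0 add0r mul1r.
Qed.

Lemma ssubst_tailP f g :
  g [::] = 0 -> (forall i, sder i g = ssubst (sder i f)) -> ssubst_tail f = g.
Proof.
by move=> g0 gS; apply: seriesP => // i; rewrite sder_ssubst_tail gS.
Qed.

(** To find f(M z) up to length n it is enough to know t(f) up to length n. *)
Lemma ssubst_eq_size (n : nat) f g :
  (forall u, (size u <= n)%N -> ssubst_tail f u = g u) ->
  forall u, (size u <= n)%N -> ssubst f u = ((f [::])%:A + M * g) u.
Proof.
move=> e u un; rewrite !seriesDE; congr (_ + _).
by apply: eq_seriesM => // v vu; apply/e/(leq_trans vu).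
Qed.

Lemma ssubst_rec_linear h : linear (ssubst_rec h).
Proof.
move=> c f g; apply/funext => u; rewrite seriesDE seriesZE.
elim: u h c f g => [|i u IH] h c f g; first by rewrite mulr0 addr0.
by rewrite !ssubst_rec_cons !linearP /= !IH seriesDE seriesZE; ring.
Qed.

Lemma ssubst_tail_linear : linear ssubst_tail.
Proof. exact: ssubst_rec_linear. Qed.

Lemma ssubst_is_linear : linear ssubst.
Proof.
move=> c f g; rewrite /ssubst ssubst_tail_linear seriesDE seriesZE.
by rewrite mulrDr -scalerAr scalerDl scalerDr scalerA addrACA.
Qed.

HB.instance Definition _ :=
  GRing.isLinear.Build K S S *:%R ssubst ssubst_is_linear.

Lemma ssubst1 : ssubst 1 = 1.
Proof.
rewrite /ssubst (_ : ssubst_tail 1 = 0) ?mulr0 ?addr0 ?scale1r //.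
by apply: ssubst_tailP => // i; rewrite sder1 !linear0.
Qed.

(** Both sides satisfy the same recursion: t(f g) = t(f) g(M z) + f[1] t(g). *)
Lemma ssubstM f g : ssubst (f * g) = ssubst f * ssubst g.
Proof.
apply/funext => u; have [n] := ubnP (size u).
elim: n f g u => // n IH f g u un.
pose t := ssubst_tail f * ssubst g + f [::] *: ssubst_tail g.
rewrite (@ssubst_eq_size n (f * g) t) //; last first.
  case=> [|i v] vn.
    rewrite /t seriesDE seriesZE seriesM0 !ssubst_tail0.
    by rewrite mul0r mulr0 addr0.
  rewrite -/(sder i _ v) -[RHS]/(sder i t v) sder_ssubst_tail sderM.
  rewrite linearD linearZ /= seriesDE IH // /t sderD sderM ssubst_tail0.
  by rewrite scale0r addr0 sderZ !sder_ssubst_tail.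
have -> : ssubst f * ssubst g =
    f [::] *: ssubst g + M * ssubst_tail f * ssubst g.
  by rewrite {1}/ssubst mulrDl -scalerAl mul1r.
rewrite {2}/ssubst scalerDr scalerA /t seriesM0 mulrDr -scalerAr mulrA.
by rewrite -!addrA; congr ((_ + _) u); rewrite addrC.
Qed.

(** The first letter of a word of f(M z) is either the first letter of f or lies
in the gap M in front of it. *)
Lemma sder_ssubst i f : M [::] = 1 ->
  sder i (ssubst f) = ssubst (sder i f) + sder i M * ssubst_tail f.
Proof.
move=> M0; rewrite /ssubst sderD sderZ sder1 scaler0 add0r sderM M0 scale1r.
by rewrite sder_ssubst_tail addrC.
Qed.

End Substitution.

(** * Weighted lattice paths *)

Section Ladder.
Variables (K : comNzRingType) (I : finType).
Variables (T : I -> I -> I -> K).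
Local Notation S := (ncseries K I).
Implicit Types (f g h : S) (u v : seq I) (w : I -> I -> K).

(** F v is to be thought of as the series of the paths that end at the word v: a
letter j of the series, acting on a word, may create a first letter j, change
the first letter k into i with weight T j i k, or annihilate a first letter j in
front of i with weight w j i.  The condition describes the last step of a path
to a nonempty word. *)
Definition ladder w (F : seq I -> S) := forall i v, F (i :: v) [::] = 0 /\
  forall j, sder j (F (i :: v)) =
    (j == i)%:R *: F v + \sum_k T j i k *: F (k :: v)
    + w j i *: F [:: j, i & v].

(** A path to i :: v passes a last time through v and then stays above v.  The
part above v does not see v, since the weights only depend on the two topmost
letters; P is the family of paths on the empty ground. *)
Lemma ladder_prod w P F : ladder w P -> P [::] = 1 -> ladder w F ->
  forall i v, F (i :: v) = P [:: i] * F v.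
Proof.
move=> LP P1 LF i v; apply/funext => u; have [n] := ubnP (size u).
elim: n F LF u i v => // n IH F LF [|j u] i v un.
  by rewrite (LF _ _).1 seriesM0 (LP _ _).1 mul0r.
rewrite seriesMS (LP _ _).1 mul0r add0r -[LHS]/(sder j _ u).
rewrite (LF _ _).2 (LP _ _).2.
rewrite P1 !mulrDl -!scalerAl mul1r mulr_suml !seriesDE !series_sumE !seriesZE.
congr (_ + _ + _).
  by apply: eq_bigr => k _; rewrite -scalerAl !seriesZE IH.
congr (_ * _).
transitivity ((P [:: j] * (P [:: i] * F v)) u).
  rewrite IH //; apply: eq_seriesM => // x xu.
  by rewrite IH // (leq_ltn_trans xu).
rewrite mulrA; apply: eq_seriesM => // x xu.
by rewrite [RHS]IH // (leq_ltn_trans xu).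
Qed.

(** The ladder whose value at the empty word is 1: these paths never return to
the ground, so that paths w [:: i] is the series E_i of the introduction. *)
Fixpoint paths_rec w u v : K :=
  match u, v with
  | [::], _ => (nilp v)%:R
  | _ :: _, [::] => 0
  | j :: u', i :: v' => (j == i)%:R * paths_rec w u' v'
      + \sum_k T j i k * paths_rec w u' (k :: v')
      + w j i * paths_rec w u' [:: j, i & v']
  end.

Definition paths w v : S := fun u => paths_rec w u v.

Lemma paths_ladder w : ladder w (paths w).
Proof.
move=> i v; split=> // j; apply/funext => u.
by rewrite !seriesDE !series_sumE.
Qed.

Lemma paths0 w : paths w [::] = 1. Proof. by apply/funext => -[]. Qed.

Lemma sder_paths w i j : sder j (paths w [:: i]) =
  (j == i)%:R%:A + \sum_k T j i k *: paths w [:: k]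
  + w j i *: (paths w [:: j] * paths w [:: i]).
Proof.
rewrite (paths_ladder _ _ _).2 paths0; congr (_ + _ *: _).
by apply: ladder_prod; [apply: paths_ladder|apply: paths0|apply: paths_ladder].
Qed.

(** Substituting the moments into the paths raises all weights by one.  The two
sides satisfy the same equations: the summand that [sder_ssubst] adds to the
image of [sder_paths] is paths w' [:: j] * ssubst M (paths w [:: i]), which
accounts for the difference between w and w' = 1 + w. *)
Lemma ssubst_paths w (M : S) : M [::] = 1 ->
  (forall i, sder i M = paths (fun j i => 1 + w j i) [:: i] * M) ->
  forall i, ssubst M (paths w [:: i]) = paths (fun j i => 1 + w j i) [:: i].
Proof.
move=> M1 DM i; apply/funext => u; have [n] := ubnP (size u).
elim: n u i => // n IH [|j u] i un.
  by rewrite /ssubst seriesDE seriesZE seriesM0 ssubst_tail0 mulr0 mul0r addr0.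
transitivity (sder j (ssubst M (paths w [:: i])) u); first by [].
transitivity (sder j (paths (fun j i => 1 + w j i) [:: i]) u); last by [].
rewrite sder_ssubst // DM -mulrA.
have -> : M * ssubst_tail M (paths w [:: i]) = ssubst M (paths w [:: i]).
  by rewrite /ssubst scale0r add0r.
rewrite !sder_paths !linearD linear_sum !linearZ /= ssubst1 ssubstM.
rewrite scalerDl scale1r !seriesDE !series_sumE -!addrA; congr (_ + (_ + _)).
  by apply: eq_bigr => k _; rewrite linearZ /= !seriesZE IH.
rewrite addrC !seriesZE; congr (_ + _ * _).
  by apply: eq_seriesM => // x xu; rewrite IH // (leq_ltn_trans xu).
by apply: eq_seriesM => // x xu; rewrite IH // (leq_ltn_trans xu).
Qed.

End Ladder.

(** * Sums over partitions *)

Section Factor.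
Variables (X : finType) (K : comNzRingType) (f : {set X} -> K).
Implicit Types (U V B : {set X}) (pi : {set {set X}}).

Lemma partitionU pi1 pi2 U V : [disjoint U & V] ->
  partition pi1 U -> partition pi2 V -> partition (pi1 :|: pi2) (U :|: V).
Proof.
move=> dUV /and3P[/eqP c1 t1 n1] /and3P[/eqP c2 t2 n2].
rewrite /partition inE negb_or n1 n2 trivIsetU ?c1 ?c2 //.
by rewrite /cover bigcup_setU -!/(cover _) c1 c2 eqxx.
Qed.

Lemma partition_ssetI pi U V : [disjoint U & V] -> partition pi (U :|: V) ->
  (forall B, B \in pi -> (B \subset U) || (B \subset V)) ->
  partition (pi ::&: U) U.
Proof.
move=> dUV /and3P[/eqP c t n] sp; apply/and3P; split; last first.
- by rewrite inE (negPf n).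
- exact: trivIsetI.
rewrite eqEsubset; apply/andP; split.
  exact: subset_trans (cover_setI _ _) (subsetIr _ _).
apply/subsetP => x xU; have : x \in cover pi by rewrite c inE xU.
case/bigcupP => B BP xB; apply/bigcupP; exists B => //; rewrite inE BP /=.
case/orP: (sp _ BP) => // /subsetP/(_ x xB) xV.
by move: dUV; rewrite disjoints_subset => /subsetP/(_ x xU); rewrite inE xV.
Qed.

Lemma ssetIU pi1 pi2 U V : [disjoint U & V] ->
  partition pi1 U -> partition pi2 V -> (pi1 :|: pi2) ::&: U = pi1.
Proof.
move=> dUV p1 p2; apply/setP => B; rewrite !inE.
apply/andP/idP => [[/orP[//|B2] BU]|B1]; last by rewrite B1 (partitionS p1 B1).
have := partition_neq0 p2 B2; rewrite -subset0 => /negP[].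
move: dUV; rewrite -setI_eq0 => /eqP <-.
by rewrite subsetI BU (partitionS p2 B2).
Qed.

(** Sorting the blocks into those inside U and those inside V is a bijection onto
pairs of partitions, inverse to the union. *)
Lemma partition_sum_factor U V (Q Q1 Q2 : pred {set {set X}}) :
  [disjoint U & V] ->
  (forall pi, partition pi (U :|: V) -> Q pi ->
     forall B, B \in pi -> (B \subset U) || (B \subset V)) ->
  (forall pi1 pi2, partition pi1 U -> partition pi2 V ->
     Q (pi1 :|: pi2) = Q1 pi1 && Q2 pi2) ->
  \sum_(pi | partition pi (U :|: V) && Q pi) \prod_(B in pi) f B =
  (\sum_(pi | partition pi U && Q1 pi) \prod_(B in pi) f B) *
  (\sum_(pi | partition pi V && Q2 pi) \prod_(B in pi) f B).
Proof.
move=> dUV QS QU; have dVU : [disjoint V & U] by rewrite disjoint_sym.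
rewrite big_distrlr pair_big /=.
rewrite (reindex_onto (fun q : {set {set X}} * {set {set X}} => q.1 :|: q.2)
  (fun pi => (pi ::&: U, pi ::&: V))) /=; last first.
  move=> pi /andP[p q]; apply/setP => B; rewrite !inE -andb_orr.
  by case: (boolP (B \in pi)) => // /(QS _ p q) ->.
apply: eq_big => [[pi1 pi2]|[pi1 pi2]] /=.
  apply/idP/idP => [/andP[/andP[p q] /eqP[e1 e2]]|].
    have p1 : partition pi1 U.
      by rewrite -e1; exact: (partition_ssetI dUV p (QS _ p q)).
    have p2 : partition pi2 V.
      rewrite -e2; apply: (@partition_ssetI _ V U) => //.
        by rewrite [V :|: U]setUC.
      by move=> B BP; rewrite orbC (QS _ p q).
    by move: q; rewrite QU // p1 p2.
  case/andP=> /andP[p1 q1] /andP[p2 q2].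
  rewrite partitionU // QU // q1 q2 /= (ssetIU dUV) //.
  by rewrite setUC (ssetIU dVU).
case/andP=> /andP[p q] /eqP[e1 e2].
rewrite (eq_bigl [predU pi1 & pi2]) => [|B]; last by rewrite !inE.
rewrite bigU //; rewrite -setI_eq0 -subset0; apply/subsetP => B.
case/setIP; rewrite -{1}e2 -{1}e1 => /setIdP[BP BU] /setIdP[_ BV].
have := partition_neq0 p BP; rewrite -subset0 => /negP[].
by move: dUV; rewrite -setI_eq0 => /eqP <-; rewrite subsetI BU.
Qed.

Lemma partition_set1 B : B != set0 -> partition [set B] B.
Proof.
by move=> B0; rewrite /partition cover1 eqxx trivIset1 inE eq_sym B0.
Qed.

Lemma big_one_block B (Q : pred {set {set X}}) : B != set0 -> Q [set B] ->
  \sum_(pi | partition pi B && (Q pi && [exists A in pi, B \subset A]))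
    \prod_(A in pi) f A = f B.
Proof.
move=> B0 QB; rewrite (big_pred1 [set B]) ?big_set1 // => pi /=.
apply/idP/eqP => [/andP[p /andP[_ /exists_inP[A AP BA]]]|->].
  have AB : A = B by apply/eqP; rewrite eqEsubset BA (partitionS p).
  apply/setP => D; rewrite inE; apply/idP/eqP => [DP|->]; last by rewrite -AB.
  have /set0Pn[x xD] := partition_neq0 p DP.
  rewrite -(def_pblock (partition_trivIset p) DP xD) -AB.
  apply: (def_pblock (partition_trivIset p) AP).
  by rewrite AB (subsetP (partitionS p DP)).
rewrite partition_set1 // QB; apply/exists_inP.
by exists B; rewrite ?inE.
Qed.

End Factor.

Section Ordered.
Variables (n : nat) (K : comNzRingType) (f : {set 'I_n} -> K).
Implicit Types (B b g s U V : {set 'I_n}) (pi : {set {set 'I_n}}).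
Implicit Types (i j k l : 'I_n).

Definition before U V := forall i j, i \in U -> j \in V -> (i < j)%N.

(** In the recursions below, b is the part of a block that has been read so far
and g the set of positions read since then, which are not in the block. *)
Definition extends b g pi :=
  [exists B in pi, (b \subset B) && [disjoint B & g]].

Lemma block_eq pi U B B' i : partition pi U -> B \in pi -> B' \in pi ->
  i \in B -> i \in B' -> B = B'.
Proof.
move=> p BP BP' iB iB'; have t := partition_trivIset p.
by rewrite -(def_pblock t BP iB) (def_pblock t BP' iB').
Qed.

Lemma before_disjoint U V : before U V -> [disjoint U & V].
Proof.
move=> UV; rewrite disjoints_subset; apply/subsetP => i iU; rewrite inE.
by apply/negP => /(UV _ _ iU); rewrite ltnn.
Qed.

Lemma disjoint_setU1 B i g :
  [disjoint B & i |: g] = (i \notin B) && [disjoint B & g].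
Proof.
rewrite -!setI_eq0 setIUr setU_eq0; congr (_ && _).
by rewrite setI_eq0 disjoint_sym disjoints1.
Qed.

(** The next position i either joins the gap g or continues the block. *)
Lemma extends_split pi U b g i : b != set0 -> partition pi U ->
  (extends b g pi && ~~ extends (i |: b) set0 pi = extends b (i |: g) pi) *
  (extends b g pi && extends (i |: b) set0 pi = extends (i |: b) g pi).
Proof.
case/set0Pn => m mb p.
have D0 B : [disjoint B & set0].
  by rewrite disjoint_sym disjoints_subset sub0set.
split; apply/idP/idP.
- case/andP=> /exists_inP[B BP /andP[bB Bg]] /exists_inPn nB.
  apply/exists_inP; exists B => //; rewrite bB /=.
  rewrite disjoint_setU1 Bg andbT.
  by move: (nB B BP); rewrite subUset sub1set bB D0 !andbT.
- case/exists_inP=> B BP /andP[bB]; rewrite disjoint_setU1.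
  case/andP=> iB Bg; apply/andP; split.
    by apply/exists_inP; exists B; rewrite ?bB.
  apply/exists_inPn => B' BP'; apply/negP.
  rewrite subUset sub1set D0 andbT => /andP[iB' bB'].
  move: iB; rewrite (block_eq p BP BP' (i := m)) ?iB' //;
    by [apply: (subsetP bB)|apply: (subsetP bB')].
- case/andP=> /exists_inP[B BP /andP[bB Bg]] /exists_inP[B' BP'].
  rewrite subUset D0 andbT => /andP[iB' bB'].
  apply/exists_inP; exists B => //; rewrite Bg andbT subUset bB andbT.
  rewrite (block_eq p BP BP' (i := m)) //;
    by [apply: (subsetP bB)|apply: (subsetP bB')].
case/exists_inP=> B BP /andP[iB Bg].
apply/andP; split; apply/exists_inP; exists B => //.
  by rewrite Bg andbT (subset_trans (subsetUr _ _) iB).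
by rewrite iB D0.
Qed.

(** The condition of [noncrossing_partitions], for partitions of subsets. *)
Definition noncrossing pi :=
  [forall B in pi, forall B' in pi,
    forall i in B, forall k in B, forall j in B', forall l in B',
    (i < j)%N && (j < k)%N && (k < l)%N ==> (B == B')].

Lemma noncrossingP pi : reflect (forall B B' i j k l, B \in pi -> B' \in pi ->
    i \in B -> k \in B -> j \in B' -> l \in B' ->
    (i < j)%N -> (j < k)%N -> (k < l)%N -> B = B') (noncrossing pi).
Proof.
apply: (iffP forall_inP) => [H B B' i j k l BP BP' iB kB jB lB ij jk kl|H B BP].
  move/forall_inP: (H B BP) => /(_ _ BP')/forall_inP/(_ _ iB)/forall_inP.
  move=> /(_ _ kB)/forall_inP/(_ _ jB)/forall_inP/(_ _ lB).
  by rewrite ij jk kl => /eqP.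
apply/forall_inP => B' BP'; apply/forall_inP => i iB; apply/forall_inP => k kB.
apply/forall_inP => j jB; apply/forall_inP => l lB; apply/implyP.
by case/andP=> /andP[ij jk] kl; rewrite (H B B' i j k l).
Qed.

(** Being an interval partition of a subset: convexity is only required among
the positions that pi covers.  See [interval_partitionsE]. *)
Definition intervalic pi :=
  [forall B in pi, forall B' in pi,
    forall i in B, forall k in B, forall j in B',
    (i < j)%N && (j < k)%N ==> (B == B')].

Lemma intervalicP pi : reflect (forall B B' i j k, B \in pi -> B' \in pi ->
    i \in B -> k \in B -> j \in B' -> (i < j)%N -> (j < k)%N -> B = B')
  (intervalic pi).
Proof.
apply: (iffP forall_inP) => [H B B' i j k BP BP' iB kB jB ij jk|H B BP].
  move/forall_inP: (H B BP) => /(_ _ BP')/forall_inP/(_ _ iB)/forall_inP.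
  by move=> /(_ _ kB)/forall_inP/(_ _ jB); rewrite ij jk => /eqP.
apply/forall_inP => B' BP'; apply/forall_inP => i iB; apply/forall_inP => k kB.
apply/forall_inP => j jB; apply/implyP.
by case/andP=> ij jk; rewrite (H B B' i j k).
Qed.

Definition nc_sum U : K :=
  \sum_(pi | partition pi U && noncrossing pi) \prod_(B in pi) f B.

Definition nc_ext_sum b g s : K :=
  \sum_(pi | partition pi (b :|: g :|: s) && (noncrossing pi && extends b g pi))
    \prod_(B in pi) f B.

Definition int_sum U : K :=
  \sum_(pi | partition pi U && intervalic pi) \prod_(B in pi) f B.

Definition int_ext_sum b s : K :=
  \sum_(pi | partition pi (b :|: s) && (intervalic pi && extends b set0 pi))
    \prod_(B in pi) f B.

Lemma extends_set1 pi U i :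
  i \in U -> partition pi U -> extends [set i] set0 pi.
Proof.
move=> iU p; have : i \in cover pi by rewrite (cover_partition p).
case/bigcupP => B BP iB; apply/exists_inP; exists B => //.
by rewrite sub1set iB disjoint_sym disjoints_subset sub0set.
Qed.

Lemma partition_sum0 (Q : pred {set {set 'I_n}}) : Q set0 ->
  \sum_(pi | partition pi set0 && Q pi) \prod_(B in pi) f B = 1.
Proof.
move=> Q0; rewrite (big_pred1 set0) ?big_set0 // => pi /=.
by rewrite partition_set0 andb_idr // => /eqP->.
Qed.

Lemma nc_sum0 : nc_sum set0 = 1.
Proof.
by apply: partition_sum0; apply/noncrossingP => B B' i j k l; rewrite inE.
Qed.

Lemma int_sum0 : int_sum set0 = 1.
Proof.
by apply: partition_sum0; apply/intervalicP => B B' i j k; rewrite inE.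
Qed.

Lemma nc_sumU1 i s : nc_sum (i |: s) = nc_ext_sum [set i] set0 s.
Proof.
rewrite /nc_ext_sum setU0; apply: eq_bigl => pi.
case: (boolP (partition _ _)) => //= p.
by rewrite (extends_set1 _ p) ?andbT // setU11.
Qed.

Lemma int_sumU1 i s : int_sum (i |: s) = int_ext_sum [set i] s.
Proof.
apply: eq_bigl => pi; case: (boolP (partition _ _)) => //= p.
by rewrite (extends_set1 _ p) ?andbT // setU11.
Qed.

(** When U lies in a single gap of V, no crossing can involve blocks of both. *)
Lemma noncrossingU pi1 pi2 U V :
  (forall i j k, i \in U -> k \in U -> j \in V ->
    (i < j)%N -> (j < k)%N -> false) ->
  partition pi1 U -> partition pi2 V ->
  noncrossing (pi1 :|: pi2) = noncrossing pi1 && noncrossing pi2.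
Proof.
move=> UV p1 p2.
apply/noncrossingP/andP => [H|[/noncrossingP H1 /noncrossingP H2]].
  split; apply/noncrossingP => B B' i j k l BP BP';
    by apply: H; rewrite inE ?BP ?BP' ?orbT.
move=> B B' i j k l /setUP[BP|BP] /setUP[BP'|BP'] iB kB jB lB ij jk kl.
- exact: H1 ij jk kl.
- have [s1 s2] := (subsetP (partitionS p1 BP), subsetP (partitionS p2 BP')).
  by have := UV i j k (s1 _ iB) (s1 _ kB) (s2 _ jB) ij jk.
- have [s1 s2] := (subsetP (partitionS p1 BP'), subsetP (partitionS p2 BP)).
  by have := UV j k l (s1 _ jB) (s1 _ lB) (s2 _ kB) jk kl.
exact: H2 ij jk kl.
Qed.

Lemma extendsU pi1 pi2 U V b g : b != set0 -> b \subset V -> g \subset U ->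
  [disjoint U & V] -> partition pi1 U -> partition pi2 V ->
  extends b g (pi1 :|: pi2) = [exists B in pi2, b \subset B].
Proof.
case/set0Pn=> m mb bV gU dUV p1 p2.
apply/exists_inP/exists_inP => [[B /setUP[BP|BP] /andP[bB Bg]]|[B BP bB]].
- have mU : m \in U by apply: (subsetP (partitionS p1 BP)); apply: (subsetP bB).
  move: dUV; rewrite disjoints_subset => /subsetP/(_ m mU).
  by rewrite inE (subsetP bV).
- by exists B.
exists B; first by rewrite inE BP orbT.
rewrite bB disjoint_sym (disjointWl gU) // (disjointWr _ dUV) //.
exact: partitionS p2 BP.
Qed.

Lemma extends0 b pi : extends b set0 pi = [exists B in pi, b \subset B].
Proof.
apply: eq_existsb => B; congr (_ && _).
by rewrite disjoint_sym disjoints_subset sub0set andbT.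
Qed.

Lemma subset_setU_or B U V : B \subset U :|: V ->
  (forall i j, i \in B -> j \in B -> i \in U -> j \in V -> false) ->
  (B \subset U) || (B \subset V).
Proof.
move=> /subsetP BUV nB; case: (boolP (B \subset U)) => //= /subsetPn[j jB jU].
apply/subsetP => i iB; case/setUP: (BUV _ iB) => // iU.
by have := BUV _ jB; rewrite inE (negPf jU) => /(nB _ _ iB jB iU).
Qed.

Lemma nc_ext_sum0 b g : b != set0 -> before b g ->
  nc_ext_sum b g set0 = nc_sum g * f b.
Proof.
move=> b0 bg; have dgb : [disjoint g & b].
  by rewrite disjoint_sym before_disjoint.
rewrite /nc_ext_sum setU0 setUC (partition_sum_factor f
  (Q1 := noncrossing)
  (Q2 := fun pi => noncrossing pi && [exists B in pi, b \subset B])) //.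
- congr (_ * _); apply: big_one_block => //; apply/noncrossingP.
  by move=> B B' i j k l /set1P-> /set1P->.
- move=> pi p /andP[_ /exists_inP[B BP /andP[bB Bg]]] B' BP'.
  apply: subset_setU_or (partitionS p BP') _ => i j iB' jB' ig jb.
  have e := block_eq p BP' BP jB' (subsetP bB _ jb); move: iB'; rewrite e => iB.
  by move: Bg; rewrite disjoints_subset => /subsetP/(_ i iB); rewrite inE ig.
move=> pi1 pi2 p1 p2; rewrite (extendsU b0 _ _ dgb p1 p2) // andbA.
rewrite (noncrossingU _ p1 p2) // => i j k ig kg jb ij jk.
by have := bg _ _ jb ig; rewrite ltnNge (ltnW ij).
Qed.

(** If i continues the block, the gap g is enclosed by the block and is
partitioned on its own: a block that leaves g would cross it. *)
Lemma nc_ext_sumU1 b g i s : b != set0 -> before b g ->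
  before (b :|: g) (i |: s) -> before [set i] s ->
  nc_ext_sum b g (i |: s) =
    nc_sum g * nc_ext_sum (i |: b) set0 s + nc_ext_sum b (i |: g) s.
Proof.
move=> b0 bg bgs is_; have bi j : j \in b -> (j < i)%N.
  by move=> jb; apply: bgs; rewrite !inE ?jb ?eqxx.
have gi j : j \in g -> (j < i)%N.
  by move=> jg; apply: bgs; rewrite !inE ?jg ?eqxx ?orbT.
have ls j : j \in s -> (i < j)%N by apply: is_; rewrite inE.
pose b' := i |: b; have b'0 : b' != set0.
  by apply/set0Pn; exists i; rewrite setU11.
have dg : [disjoint g & b' :|: s].
  rewrite disjoints_subset; apply/subsetP => j jg; rewrite !inE; apply/negP.
  case/orP=> [/orP[/eqP e|jb]|js].
  - by have := gi _ jg; rewrite e ltnn.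
  - by have := bg _ _ jb jg; rewrite ltnn.
  by have := ltn_trans (gi _ jg) (ls _ js); rewrite ltnn.
rewrite /nc_ext_sum (bigID (extends b' set0)) /=; congr (_ + _); last first.
  apply: eq_big => // pi.
  rewrite (_ : b :|: g :|: (i |: s) = b :|: (i |: g) :|: s); last first.
    by apply/setP => j; rewrite !inE; do !case: (_ \in _) => //; case: eqP.
  case: (boolP (partition _ _)) => //= p; rewrite -andbA; congr (_ && _).
  exact: (extends_split _ _ b0 p).1.
have -> : b :|: g :|: (i |: s) = g :|: (b' :|: s).
  by apply/setP => j; rewrite !inE; do !case: (_ \in _) => //; case: eqP.
rewrite setU0 -(partition_sum_factor f
  (Q := fun pi => noncrossing pi && extends b' g pi)) //.
- apply: eq_bigl => pi; case: (boolP (partition _ _)) => //= p.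
  by rewrite -andbA (extends_split _ _ b0 p).2.
- move=> pi p /andP[/noncrossingP nc /exists_inP[B BP /andP[bB Bg]]] B' BP'.
  apply: subset_setU_or (partitionS p BP') _ => j k jB' kB' jg kV.
  have BB : B' = B -> false.
    move=> e; move: jB'; rewrite e => jB.
    by move: Bg; rewrite disjoints_subset => /subsetP/(_ j jB); rewrite inE jg.
  case/setUP: kV => [kb|ks].
    by apply: BB; apply: (block_eq p BP' BP kB'); apply: (subsetP bB).
  (* m < j < i < k with m, i in B and j, k in B' *)
  have /set0Pn[m mb] := b0; apply/BB/esym.
  apply: (nc B B' m j i k); rewrite ?gi ?ls ?(bg m j) //;
    by apply: (subsetP bB); rewrite !inE ?eqxx ?mb ?orbT.
move=> pi1 pi2 p1 p2.
rewrite (extendsU b'0 _ _ dg p1 p2) ?subsetUl // extends0 andbA.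
rewrite (noncrossingU _ p1 p2) // => j k l jg lg kV jk kl.
move: kV; rewrite !inE -orbA => /or3P[/eqP e|kb|ks].
- by have := gi _ lg; rewrite -e ltnNge (ltnW kl).
- by have := bg _ _ kb jg; rewrite ltnNge (ltnW jk).
by have := ltn_trans kl (ltn_trans (gi _ lg) (ls _ ks)); rewrite ltnn.
Qed.

Lemma intervalicU pi1 pi2 U V : before V U ->
  partition pi1 U -> partition pi2 V ->
  intervalic (pi1 :|: pi2) = intervalic pi1 && intervalic pi2.
Proof.
move=> VU p1 p2.
apply/intervalicP/andP => [H|[/intervalicP H1 /intervalicP H2]].
  split; apply/intervalicP => B B' i j k BP BP';
    by apply: H; rewrite inE ?BP ?BP' ?orbT.
move=> B B' i j k /setUP[BP|BP] /setUP[BP'|BP'] iB kB jB ij jk.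
- exact: H1 ij jk.
- have [s1 s2] := (subsetP (partitionS p1 BP), subsetP (partitionS p2 BP')).
  by have := VU j i (s2 _ jB) (s1 _ iB); rewrite ltnNge (ltnW ij).
- have [s1 s2] := (subsetP (partitionS p1 BP'), subsetP (partitionS p2 BP)).
  by have := VU k j (s2 _ kB) (s1 _ jB); rewrite ltnNge (ltnW jk).
exact: H2 ij jk.
Qed.

Lemma int_ext_sum0 b : b != set0 -> int_ext_sum b set0 = f b.
Proof.
move=> b0; rewrite /int_ext_sum setU0.
under eq_bigl => pi do rewrite extends0.
apply: big_one_block => //; apply/intervalicP.
by move=> B B' i j k /set1P-> /set1P->.
Qed.

(** If i does not continue the block, the block is complete. *)
Lemma int_ext_sumU1 b i s : b != set0 -> before b (i |: s) ->
  before [set i] s ->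
  int_ext_sum b (i |: s) = int_sum (i |: s) * f b + int_ext_sum (i |: b) s.
Proof.
move=> b0 bs is_; have bi j : j \in b -> (j < i)%N.
  by move=> jb; apply: bs => //; rewrite setU11.
have ls j : j \in s -> (i < j)%N by apply: is_; rewrite inE.
have ds : [disjoint i |: s & b] by rewrite disjoint_sym before_disjoint.
rewrite /int_ext_sum (bigID (extends (i |: b) set0)) /= addrC.
congr (_ + _); last first.
  apply: eq_bigl => pi.
  rewrite setUCA setUA; case: (boolP (partition _ _)) => //= p.
  by rewrite -andbA (extends_split _ _ b0 p).2.
rewrite setUC -(int_ext_sum0 b0) /int_ext_sum setU0 -(partition_sum_factor f
  (Q := fun pi => intervalic pi && extends b [set i] pi)) //.
- apply: eq_bigl => pi; case: (boolP (partition _ _)) => //= p.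
  by rewrite -andbA (extends_split _ _ b0 p).1 setU0.
- move=> pi p /andP[/intervalicP il /exists_inP[B BP /andP[bB iB]]] B' BP'.
  apply: subset_setU_or (partitionS p BP') _ => j k jB' kB' jU kb.
  have e : B' = B by apply: (block_eq p BP' BP kB'); apply: (subsetP bB).
  have {}iB : i \notin B by move: iB; rewrite disjoint_sym disjoints1.
  move: jU; rewrite e in jB'; rewrite !inE => /orP[/eqP ji|js].
    by rewrite -ji jB' in iB.
  have ip : i \in cover pi by rewrite (cover_partition p) !inE eqxx.
  have [A AP iA] := bigcupP ip; move: iB.
  (* i lies between k and j, which are both in B *)
  have -> // := il B A k i j BP AP (subsetP bB _ kb) jB' iA (bi _ kb) (ls _ js).
  by rewrite iA.
move=> pi1 pi2 p1 p2.
rewrite (extendsU b0 _ _ ds p1 p2) ?sub1set ?setU11 // extends0 andbA.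
by rewrite (intervalicU _ p1 p2).
Qed.

End Ordered.

(** * Cumulants and equations between series *)

Definition sderw (K : comNzRingType) I v (f : ncseries K I) : ncseries K I :=
  fun u => f (v ++ u).

Lemma sderw_rcons (K : comNzRingType) I v i (f : ncseries K I) :
  sderw (rcons v i) f = sder i (sderw v f).
Proof. by apply/funext => u; rewrite /sderw cat_rcons. Qed.

Section Positions.
Variables (d : nat) (K : comNzRingType) (u : seq 'I_d).
Local Notation n := (size u).
Local Notation pos := 'I_(size u).
Local Notation S := (ncseries K 'I_d).
Variables (M k : S).
Hypothesis M0 : M [::] = 1.
Implicit Types (b g s t : seq pos).

(** The lists of positions are increasing, so that [subword] reads them in this
order. *)
Definition letters t : seq 'I_d := map (tnth (in_tuple u)) t.
Local Notation incr := (sorted (fun i j : pos => (i < j)%N)).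
Local Notation f := (fun B : {set pos} => k (subword B)).

Lemma incr_enum : incr (enum pos).
Proof.
have /= <- := @sorted_map _ _ (val : pos -> nat) ltn (enum pos).
by rewrite val_enum_ord iota_ltn_sorted.
Qed.

Let incr_trans : transitive (fun i j : pos => (i < j)%N).
Proof. by move=> ? ? ?; apply: ltn_trans. Qed.

Lemma subword_letters t : incr t -> subword [set x in t] = letters t.
Proof.
move=> ts; rewrite /subword /letters /image_mem; congr map.
apply: (@irr_sorted_eq _ (fun i j : pos => (i < j)%N)) => //.
- by move=> ?; rewrite ltnn.
- rewrite /enum_mem; apply: (sorted_filter incr_trans).
  by rewrite -enumT; apply: incr_enum.
by move=> x; rewrite mem_enum inE.
Qed.

Lemma incr_cat s t : incr (s ++ t) ->
  [/\ incr s, incr t & before [set x in s] [set x in t]].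
Proof.
rewrite !(sorted_pairwise incr_trans) pairwise_cat.
case/and3P=> /allrelP st -> ->; split=> //.
by move=> i j; rewrite !inE; apply: st.
Qed.

Lemma set_rcons (i : pos) b : [set x in rcons b i] = i |: [set x in b].
Proof. by apply/setP => x; rewrite !inE mem_rcons inE. Qed.

Lemma set_neq0 b : b != [::] -> [set x in b] != set0.
Proof.
by case: b => // i b _; apply/set0Pn; exists i; rewrite !inE eqxx.
Qed.

Lemma before_cat b g s : incr (b ++ g ++ s) ->
  [/\ before [set x in b] [set x in g],
      before ([set x in b] :|: [set x in g]) [set x in s] & incr s].
Proof.
move=> bgs; have [_ gs_i b_gs] := incr_cat bgs.
have [_ s_i g_s] := incr_cat gs_i.
split=> // i j; rewrite ?inE => ib jg.
  by apply: b_gs; rewrite inE ?mem_cat ?jg.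
case/orP: ib => [ib|ig]; last by apply: g_s; rewrite inE.
by apply: b_gs; rewrite inE ?mem_cat ?jg ?orbT.
Qed.

Section Free.
Hypothesis DM : forall i, sder i M = ssubst M (sder i k) * M.

(** The sum over the non-crossing partitions of v, w and a further word u in
which v is part of a block that avoids w, as a series in u: either the block
goes on after w, or it is v. *)
Let ext v w : S := sderw w M * ssubst_tail M (sderw v k) * M + k v *: sderw w M.

Lemma ext_nil v : ext v [::] = ssubst M (sderw v k) * M.
Proof.
by rewrite /ext /ssubst mulrDl -scalerAl mul1r /sderw cats0 addrC.
Qed.

Lemma sder_ext v w i : sder i (ext v w) =
  M w *: ext (rcons v i) [::] + ext v (rcons w i).
Proof.
rewrite ext_nil /ext !sderw_rcons sderD sderZ !sderM seriesM0 ssubst_tail0.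
rewrite mulr0 scale0r addr0 sder_ssubst_tail mulrDl -scalerAl.
by rewrite -addrA addrCA; congr (_ *: _ + _); rewrite /sderw cats0.
Qed.

Lemma nc_ext_sum_letters p :
  (forall t, incr t -> (size t <= p)%N ->
    nc_sum f [set x in t] = M (letters t)) ->
  forall s b g, incr (b ++ g ++ s) -> b != [::] -> (size g + size s <= p)%N ->
  nc_ext_sum f [set x in b] [set x in g] [set x in s] =
    ext (letters b) (letters g) (letters s).
Proof.
move=> IH; elim=> [|i s IHs] b g bgs b0 gp.
  have [b_g _ _] := before_cat bgs; have [bi] := incr_cat bgs.
  rewrite cats0 => gi _; rewrite set_nil nc_ext_sum0 ?set_neq0 //.
  rewrite IH //; last by rewrite -[size g]addn0.
  rewrite subword_letters // /ext seriesDE seriesZE !seriesM0 ssubst_tail0.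
  by rewrite mulr0 mul0r add0r mulrC /sderw cats0.
have [b_g bg_s si] := before_cat bgs; have [bi gsi _] := incr_cat bgs.
have [gi _ _] := incr_cat gsi.
have [_ _ i_s] := incr_cat (si : incr ([:: i] ++ s)).
have bs0 : [set x in b] != set0 by exact: set_neq0.
rewrite set_cons in bg_s; rewrite set_seq1 in i_s.
rewrite set_cons nc_ext_sumU1 //.
rewrite -!set_rcons IH //; last by rewrite (leq_trans _ gp) // leq_addr.
have -> : set0 = [set x in [::]] :> {set pos} by rewrite set_nil.
rewrite (IHs (rcons b i) [::]).
- rewrite (IHs b (rcons g i)).
  + rewrite -[RHS]/(sder _ (ext _ _) (letters s)) sder_ext seriesDE seriesZE.
    by rewrite /letters !map_rcons.
  + by rewrite cat_rcons.
  + by [].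
  + by rewrite size_rcons addSnnS.
- rewrite cat_rcons cat0s.
  apply: (subseq_sorted incr_trans) bgs.
  by rewrite cat_subseq // suffix_subseq.
- by rewrite -size_eq0 size_rcons.
by rewrite (leq_trans _ gp) // add0n addnS ltnW // ltnS leq_addl.
Qed.

Lemma nc_sum_letters t : incr t -> nc_sum f [set x in t] = M (letters t).
Proof.
have [p] := ubnP (size t); elim: p t => // p IH [|i s] tp ti.
  by rewrite set_nil nc_sum0 M0.
rewrite set_cons nc_sumU1 -set_seq1.
have -> : set0 = [set x in [::]] :> {set pos} by rewrite set_nil.
rewrite (nc_ext_sum_letters (p := p.-1)) //; last by move: tp; case: (p).
  by rewrite ext_nil -[RHS]/(sder _ M _) DM.
by move=> t ti' tp'; apply: IH => //; move: tp tp'; case: (p).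
Qed.

End Free.

Section Boolean.
Hypothesis DM : forall i, sder i M = sder i k * M.

Lemma int_ext_sum_letters p :
  (forall t, incr t -> (size t <= p)%N ->
    int_sum f [set x in t] = M (letters t)) ->
  forall s b, incr (b ++ s) -> b != [::] -> (size s <= p)%N ->
  int_ext_sum f [set x in b] [set x in s] =
    (sderw (letters b) k * M) (letters s).
Proof.
move=> IH; elim=> [|i s IHs] b bs b0 sp.
  rewrite cats0 in bs; rewrite set_nil int_ext_sum0 ?set_neq0 //.
  by rewrite subword_letters // seriesM0 M0 mulr1 /sderw cats0.
have [bi si b_s] := incr_cat bs; have bs0 := set_neq0 b0.
have [_ _ i_s] := incr_cat (si : incr ([:: i] ++ s)); rewrite set_seq1 in i_s.
have IHi := IH _ si sp; rewrite set_cons in b_s IHi.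
rewrite set_cons int_ext_sumU1 // IHi -set_rcons IHs.
- rewrite /= seriesMS -sderw_rcons /letters map_rcons subword_letters //.
  by rewrite mulrC {2}/sderw cats0.
- by rewrite cat_rcons.
- by rewrite -size_eq0 size_rcons.
exact: ltnW.
Qed.

Lemma int_sum_letters t : incr t -> int_sum f [set x in t] = M (letters t).
Proof.
have [p] := ubnP (size t); elim: p t => // p IH [|i s] tp ti.
  by rewrite set_nil int_sum0 M0.
rewrite set_cons int_sumU1 -set_seq1 (int_ext_sum_letters (p := p.-1)) //.
- by rewrite -[RHS]/(sder _ M _) DM.
- by move=> t ti' tp'; apply: IH => //; move: tp tp'; case: (p).
by move: tp; case: (p).
Qed.

End Boolean.

Lemma letters_enum : letters (enum pos) = u.
Proof. exact: (map_tnth_enum (in_tuple u)). Qed.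

Lemma set_enumT : [set x in enum pos] = [set: pos].
Proof. by apply/setP => x; rewrite !inE mem_enum. Qed.

Lemma interval_partitionsE (pi : {set {set pos}}) :
  (pi \in interval_partitions n) =
  partition pi [set: pos] && intervalic pi.
Proof.
rewrite inE; case: (boolP (partition _ _)) => //= p.
have t := partition_trivIset p.
apply/idP/intervalicP => [/forall_inP H B B' i j l BP BP' iB lB jB' ij jl|H].
  apply: (block_eq p BP BP' _ jB').
  move/forall_inP: (H B BP) => /(_ i iB)/forall_inP/(_ l lB)/forallP/(_ j).
  by rewrite (ltnW ij) (ltnW jl).
apply/forall_inP => B BP; apply/forall_inP => i iB; apply/forall_inP => l lB.
apply/forallP => j; apply/implyP => /andP[].
rewrite leq_eqVlt => /orP[/eqP/val_inj<- //|ij].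
rewrite leq_eqVlt => /orP[/eqP/val_inj-> //|jl].
have : j \in cover pi by rewrite (cover_partition p) inE.
by case/bigcupP => B' BP' jB'; rewrite (H B B' i j l).
Qed.

End Positions.

Section Cumulants.
Variables (K : numClosedFieldType) (d : nat) (phi : {scalar ncpoly K d}).
Variables (M k : ncseries K 'I_d).
Hypothesis M0 : M [::] = 1.
Hypothesis phiM : forall u, phi (xword K u) = M u.

(** The word that [sder i k * M] cuts off after the letter i is the rest of the
block of the first letter. *)
Lemma boolean_cumulant_eq : (forall i, sder i M = sder i k * M) ->
  forall u, u != [::] -> k u = boolean_cumulant phi u.
Proof.
move=> DM; apply: (cumulant_unique good_interval_partitions) => u _.
under eq_bigl => pi do rewrite interval_partitionsE.
rewrite phiM -{1}[u]letters_enum -(int_sum_letters M0 DM (incr_enum u)).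
by rewrite set_enumT.
Qed.

(** The block of the first letter i contributes a coefficient of sder i k; the
partitions of the gaps in front of its further letters give the substituted
factors M, and what follows the block gives the last factor. *)
Lemma free_cumulant_eq : (forall i, sder i M = ssubst M (sder i k) * M) ->
  forall u, u != [::] -> k u = free_cumulant phi u.
Proof.
move=> DM; apply: (cumulant_unique good_noncrossing_partitions) => u _.
rewrite phiM -{1}[u]letters_enum -(nc_sum_letters M0 DM (incr_enum u)).
by rewrite set_enumT; apply: eq_bigl => pi; rewrite inE.
Qed.

End Cumulants.

(** * Moments of the free Meixner functionals *)

Section MeixnerMoments.
Variables (K : numClosedFieldType) (d : nat).
Local Notation A := (ncpoly K d).
Local Notation S := (ncseries K 'I_d).
Implicit Types (u v : seq 'I_d) (p q : A).
Variables (C : 'M[K]_(d * d)) (T : 'I_d -> 'M[K]_d).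
Local Notation P := (meixner_poly C T).
Local Notation wt := (fun j i => 1 + diag_entry C j i).

Lemma xword_cons i u : xword K (i :: u) = xword K [:: i] * xword K u.
Proof.
rewrite /xword malgM_def fgmulUU mulr1; congr << _ >>.
exact/esym/fmmulE.
Qed.

Lemma malg_scalerAr c p q : p * (c *: q) = c *: (p * q).
Proof.
have -> : c *: q = c%:MP * q by rewrite mul_malgC.
rewrite scalerAl mulrA; congr (_ * _).
rewrite malgM_def fgmulgU malgZ_def /fgscale; apply: eq_bigr => k _.
by rewrite monalg.mulm1 mulrC.
Qed.

(** The shape of the right-hand side of [meixner_poly_rec], with opaque terms:
rewriting with linearity there would unfold the polynomials. *)
Lemma scalar_combE (f : {scalar A}) n (a : 'I_n -> K) (g : 'I_n -> A)
    (c : K) p q :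
  f (p + \sum_(k < n) a k *: g k + c *: q)
  = f p + \sum_(k < n) a k * f (g k) + c * f q.
Proof.
rewrite !linearD linear_sum linearZ; congr (_ + _ + _).
by apply: eq_bigr => k _; rewrite linearZ.
Qed.

Lemma meixner_span (Q : A -> Prop) : Q 0 ->
  (forall c p q, Q p -> Q q -> Q (c *: p + q)) ->
  (forall u, Q (P u)) -> forall p, Q p.
Proof.
move=> Q0 QD QP p; have [rep [fb [_ fbE fbK]]] := meixner_basis C T.
rewrite -(fbK p) (linear_wordE fb); elim/big_ind: _ => //.
  by move=> x y Qx Qy; rewrite -[x]scale1r; apply: QD.
by move=> m _; rewrite -[_ *: _]addr0 fbE; apply: QD.
Qed.

(** The dual basis of the P_u. *)
Lemma exists_meixner_coord : exists c : seq 'I_d -> {scalar A},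
  forall u v, c v (P u) = (v == u)%:R.
Proof.
have [rep [_ [repP _ _]]] := meixner_basis C T.
exists (fun v => scalext (fun m => mcoeff (FMonom v) (rep (xword K m)))).
move=> u v; pose f p := mcoeff (FMonom v) (rep p : A).
rewrite (_ : (v == u)%:R = f (P u)); last first.
  by rewrite /f repP mcoeffU1 -val_eqE eq_sym.
move: (P u) => p; rewrite /f (linear_wordE rep p) raddf_sum.
by apply: eq_bigr => m _; rewrite [RHS]mcoeffZ.
Qed.

Section Coord.
Variable c : seq 'I_d -> {scalar A}.
Hypothesis cP : forall u v, c v (P u) = (v == u)%:R.

Lemma coord0_mulx j p : c [::] (xword K [:: j] * p) = c [:: j] p.
Proof.
elim/meixner_span: p => [|a p q IHp IHq|[|k u]].
- by rewrite mulr0 !linear0.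
- by rewrite mulrDr malg_scalerAr !linearP /= IHp IHq.
- rewrite meixner_poly0 mulr1 -(meixner_poly0 C T) cP.
  by rewrite [xword _ _](meixner_poly1 C T) cP.
rewrite meixner_poly_rec scalar_combE !cP.
rewrite big1 => [|l _]; last by rewrite cP mulr0.
rewrite !add0r -mulrA; case: eqP => [->|/eqP jk] /=; last first.
  by rewrite mul0r eqseq_cons (negPf jk).
rewrite mul1r eqseq_cons eqxx eq_sym /=.
by case: u => [|? ?] /=; rewrite ?mulr1 ?mulr0.
Qed.

(** Read on coordinates, the recursion of the P_u is a step of a path that ends
at i :: v. *)
Lemma coord_mulx j i v p : c (i :: v) (xword K [:: j] * p) =
  (j == i)%:R * c v p + \sum_k T j i k * c (k :: v) p
  + wt j i * c [:: j, i & v] p.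
Proof.
elim/meixner_span: p => [|a p q IHp IHq|[|k u]].
- by rewrite mulr0 !linear0 !mulr0 big1 ?addr0 // => l _; rewrite linear0 mulr0.
- rewrite mulrDr malg_scalerAr !linearP /= IHp IHq.
  under [X in _ = _ + X + _]eq_bigr => l _ do rewrite linearP /= mulrDr mulrCA.
  by rewrite big_split -mulr_sumr /=; ring.
- rewrite meixner_poly0 mulr1 -(meixner_poly0 C T) !cP.
  rewrite [xword _ _](meixner_poly1 C T) cP.
  rewrite eqseq_cons -natrM mulnb eq_sym big1 ?mulr0 ?addr0 // => l _.
  by rewrite cP mulr0.
rewrite meixner_poly_rec scalar_combE !cP.
congr (_ + _ + _).
- by rewrite eqseq_cons -natrM mulnb eq_sym.
- under eq_bigr => l _ do rewrite cP eqseq_cons -mulnb natrM mulrA mulrC.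
  under [RHS]eq_bigr => l _ do rewrite cP eqseq_cons -mulnb natrM mulrA mulrC.
  rewrite -!mulr_sumr; congr (_ * _).
  rewrite (bigD1 i) //= eqxx mulr1 big1 ?addr0 => [|l li]; last first.
    by rewrite eq_sym (negPf li) mulr0.
  rewrite (bigD1 k) //= eqxx mulr1 big1 ?addr0 => [//|l lk].
  by rewrite (negPf lk) mulr0.
rewrite eqseq_cons; have [_|jk] := eqVneq j k; last by rewrite !mul0r mulr0.
rewrite mul1r; have [->|_] := eqVneq u (i :: v); first by [].
by rewrite !mulr0.
Qed.

End Coord.

(** The coordinates of the monomials form a ladder, and the one at the empty
word is the functional itself. *)
Lemma meixner_moments (M : S) :
  (forall u, M u = free_meixner_functional C T (xword K u)) ->
  M [::] = 1 /\ forall i, sder i M = paths T wt [:: i] * M.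
Proof.
move=> ME; have [c cP] := exists_meixner_coord.
have phiE : c [::] =1 free_meixner_functional C T.
  apply/free_meixner_functionalP; split=> [|u u0].
    by rewrite -(meixner_poly0 C T) cP.
  by rewrite cP eq_sym (negPf u0).
pose m v : S := fun u => c v (xword K u).
have mL : ladder T wt m.
  move=> i v; split; first by rewrite /m xword0 -(meixner_poly0 C T) cP.
  move=> j; apply/funext => u; rewrite !seriesDE !series_sumE.
  by rewrite /sder /m xword_cons coord_mulx.
have -> : M = m [::] by apply/funext => u; rewrite ME -phiE.
split=> [|i]; first by rewrite /m xword0 -(meixner_poly0 C T) cP.
rewrite -(ladder_prod (@paths_ladder _ _ T wt) (@paths0 _ _ T wt) mL).
by apply/funext => u; rewrite /sder /m xword_cons coord0_mulx.
Qed.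

End MeixnerMoments.

(** * Positivity *)

Section Positivity.
Local Open Scope sesquilinear_scope.
Variables (K : numClosedFieldType) (d : nat).
Local Notation A := (ncpoly K d).
Implicit Types (u v w : seq 'I_d) (p q r : A) (i j k l : 'I_d).

Lemma mcoeff_ncstar p v :
  mcoeff (FMonom v) (ncstar p) = (mcoeff (FMonom (rev v)) p)^*.
Proof.
rewrite /ncstar raddf_sum /=.
have E (m : {fmonom 'I_d}) :
    (FMonom (rev m) == FMonom v) = (m == FMonom (rev v)).
  by rewrite -!val_eqE /= -[v]revK (can_eq revK) revK.
under eq_bigr => m _ do rewrite mcoeffU E.
case: (boolP (FMonom (rev v) \in msupp p)) => vp.
  rewrite (bigD1_seq (FMonom (rev v))) ?fset_uniq //= eqxx big1 ?addr0 // => m.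
  by move/negPf->.
rewrite (mcoeff_outdom vp) conjC0 big_seq big1 // => m mp.
by case: eqP vp => // <-; rewrite mp.
Qed.

Lemma ncstarP c p q : ncstar (c *: p + q) = c^* *: ncstar p + ncstar q.
Proof.
apply/malgP => m; rewrite -[m]fmK !(mcoeffD, mcoeffZ, mcoeff_ncstar).
by rewrite rmorphD rmorphM.
Qed.

Lemma ncstar_word u : ncstar (xword K u) = xword K (rev u).
Proof.
apply/malgP => m; rewrite -[m]fmK mcoeff_ncstar !mcoeffU1 conjC_nat.
by congr _%:R; rewrite -!val_eqE /= -{1}[u]revK (can_eq revK).
Qed.

Lemma xword_cat u v : xword K (u ++ v) = xword K u * xword K v.
Proof.
elim: u => [|i u IH]; first by rewrite xword0 mul1r.
by rewrite cat_cons xword_cons [xword K (i :: u)]xword_cons IH mulrA.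
Qed.

Lemma ncstar1 : ncstar (1 : A) = 1.
Proof. by rewrite -xword0 ncstar_word. Qed.

Lemma ncstar0 : ncstar (0 : A) = 0.
Proof. by rewrite /ncstar msupp0 big_nil. Qed.

Lemma word_span (Q : A -> Prop) : Q 0 ->
  (forall c p q, Q p -> Q q -> Q (c *: p + q)) ->
  (forall u, Q (xword K u)) -> forall p, Q p.
Proof.
move=> Q0 QD QP p; rewrite [p]ncpolyE; elim/big_ind: _ => //.
  by move=> x y Qx Qy; rewrite -[x]scale1r; apply: QD.
by move=> m _; rewrite -[_ *: _]addr0; apply: QD.
Qed.

Lemma ncstar_mulx i p :
  ncstar (xword K [:: i] * p) = ncstar p * xword K [:: i].
Proof.
elim/word_span: p => [|c p q IHp IHq|u].
- by rewrite mulr0 ncstar0 mul0r.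
- by rewrite mulrDr malg_scalerAr !ncstarP IHp IHq mulrDl scalerAl.
by rewrite -(xword_cons K i u) !ncstar_word rev_cons -cats1 xword_cat.
Qed.

Section Gram.
Variable phi : {scalar A}.

Definition gram p q : K := phi (ncstar p * q).

Lemma gram1 q : gram 1 q = phi q. Proof. by rewrite /gram ncstar1 mul1r. Qed.

Lemma gram_mulx i p q :
  gram (xword K [:: i] * p) q = gram p (xword K [:: i] * q).
Proof. by rewrite /gram ncstar_mulx mulrA. Qed.

Lemma gramPl c p q r : gram (c *: p + q) r = c^* * gram p r + gram q r.
Proof. by rewrite /gram ncstarP mulrDl -scalerAl linearP. Qed.

Lemma gramPr c p q r : gram r (c *: p + q) = c * gram r p + gram r q.
Proof. by rewrite /gram mulrDr malg_scalerAr linearP. Qed.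

Lemma gram0l r : gram 0 r = 0.
Proof. by rewrite /gram ncstar0 mul0r linear0. Qed.

Lemma gram0r r : gram r 0 = 0.
Proof. by rewrite /gram mulr0 linear0. Qed.

Lemma gram_suml (I : Type) (s : seq I) (a : I -> K) (g : I -> A) r :
  gram (\sum_(m <- s) a m *: g m) r = \sum_(m <- s) (a m)^* * gram (g m) r.
Proof.
elim: s => [|m s IH]; first by rewrite !big_nil gram0l.
by rewrite !big_cons gramPl IH.
Qed.

Lemma gram_sumr (I : Type) (s : seq I) (a : I -> K) (g : I -> A) r :
  gram r (\sum_(m <- s) a m *: g m) = \sum_(m <- s) a m * gram r (g m).
Proof.
elim: s => [|m s IH]; first by rewrite !big_nil gram0r.
by rewrite !big_cons gramPr IH.
Qed.

Lemma gramDl p q r : gram (p + q) r = gram p r + gram q r.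
Proof. by rewrite -[p]scale1r gramPl rmorph1 mul1r scale1r. Qed.

Lemma gramDr p q r : gram r (p + q) = gram r p + gram r q.
Proof. by rewrite -[p]scale1r gramPr mul1r scale1r. Qed.

Lemma gramZl c p r : gram (c *: p) r = c^* * gram p r.
Proof. by rewrite -[c *: p]addr0 gramPl gram0l addr0. Qed.

Lemma gramZr c p r : gram r (c *: p) = c * gram r p.
Proof. by rewrite -[c *: p]addr0 gramPr gram0r addr0. Qed.

Lemma gram_combl (a : 'I_d -> K) (g : 'I_d -> A) c p q r :
  gram (p + \sum_k a k *: g k + c *: q) r
  = gram p r + \sum_k (a k)^* * gram (g k) r + c^* * gram q r.
Proof. by rewrite !gramDl gram_suml gramZl. Qed.

Lemma gram_combr (a : 'I_d -> K) (g : 'I_d -> A) c p q r :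
  gram r (p + \sum_k a k *: g k + c *: q)
  = gram r p + \sum_k a k * gram r (g k) + c * gram r q.
Proof. by rewrite !gramDr gram_sumr gramZr. Qed.

End Gram.

Section Data.
Variables (C : 'M[K]_(d * d)) (T : 'I_d -> 'M[K]_d).
Local Notation P := (meixner_poly C T).
Local Notation phi := (free_meixner_functional C T).
Hypothesis CT : meixner_data C T.

Lemma meixner_herm i k j : (T i j k)^* = T i k j.
Proof.
have [hT _ _ _] := CT; have /is_hermitianmxP := hT i.
by rewrite expr0 scale1r => e; rewrite [in RHS]e !mxE.
Qed.

(** The entry at ((k, a), (j, a)) of the commutation hypothesis. *)
Lemma meixner_comm i k j a :
  T i k j * diag_entry C j a = T i k j * diag_entry C k a.
Proof.
have [_ /is_diag_mxP dC _ /(_ i)] := CT.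
move=> /matrixP/(_ (mxtens_index (k, a)) (mxtens_index (j, a))).
rewrite !mxE (bigD1 (mxtens_index (j, a))) //= big1 ?addr0; last first.
  by move=> x xj; rewrite dC ?mulr0.
rewrite (bigD1 (mxtens_index (k, a))) //= big1 ?addr0 => [|x xk]; last first.
  by rewrite dC ?mul0r // eq_sym.
by rewrite !tensmxE [1%:M a a]mxE eqxx mulr1 => ->; rewrite mulrC.
Qed.

Lemma meixner_weight_ge0 i u : 0 <= meixner_weight C i u.
Proof.
case: u => [|a u] /=; first exact: ler01.
have [_ _ [_ psd] _] := CT.
pose x := mxtens_index (i, a); have := psd (delta_mx x 0).
have -> : (delta_mx x 0 : 'cV[K]_(d * d)) ^t* = delta_mx 0 x.
  apply/matrixP => r s; rewrite !mxE andbC.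
  by case: (_ && _); rewrite ?conjC0 ?conjC1.
by rewrite -rowE -colE !mxE eqxx.
Qed.

Fixpoint sqnorm u : K :=
  if u is i :: u' then meixner_weight C i u' * sqnorm u' else 1.

(** T_i only mixes first letters that have the same weight. *)
Lemma sqnorm_comm i k j u :
  T i k j * sqnorm (j :: u) = T i k j * sqnorm (k :: u).
Proof.
case: u => [//|a u] /=.
by rewrite !mulrA; congr (_ * _); rewrite !mulrDr meixner_comm.
Qed.

Lemma sum_pick i (a : 'I_d -> K) (b : bool) (h : 'I_d -> K) :
  \sum_k a k * (((i == k) && b)%:R * h k) = a i * (b%:R * h i).
Proof.
rewrite (bigD1 i) //= eqxx big1 ?addr0 // => k ki.
by rewrite eq_sym (negPf ki) mul0r mulr0.
Qed.

Lemma gram_meixner_cons i j w q : gram phi (P [:: i, j & w]) q =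
  gram phi (P (j :: w)) (xword K [:: i] * q)
  - \sum_k T i j k * gram phi (P (k :: w)) q
  - (i == j)%:R * meixner_weight C i w * gram phi (P w) q.
Proof.
have := gram_combl phi (T i ^~ j) (fun k => P (k :: w))
  ((i == j)%:R * meixner_weight C i w) (P [:: i, j & w]) (P w) q.
rewrite -meixner_poly_rec gram_mulx => ->.
have -> : ((i == j)%:R * meixner_weight C i w)^* =
    (i == j)%:R * meixner_weight C i w :> K.
  by rewrite rmorphM /= conjC_nat (geC0_conj (meixner_weight_ge0 i w)).
rewrite (eq_bigr (fun k => T i j k * gram phi (P (k :: w)) q)); last first.
  by move=> k _; rewrite meixner_herm.
by rewrite addrAC !addrK.
Qed.

(** Induction on u, for all v: in the scalar product with P_(i, j, w) the factor
x_i is moved to P_v.  The terms with T_i cancel by [sqnorm_comm], those in which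
i annihilates j cancel against those in which x_i creates i in front of v, and
what remains is the annihilation of the first letter of v. *)
Lemma meixner_orthogonal u v : gram phi (P u) (P v) = (u == v)%:R * sqnorm u.
Proof.
have [phi1 phi0] := (free_meixner_functionalP C T phi).2 (fun=> erefl).
have phiP w : phi (P w) = (w == [::])%:R.
  by case: w => [|i w]; rewrite ?phi1 ?phi0.
have [n] := ubnP (size u); elim: n u v => // n IH [|i [|j w]] v un.
- by rewrite meixner_poly0 gram1 phiP eq_sym mulr1.
- rewrite -meixner_poly1 -[xword _ _]mulr1 gram_mulx gram1 /= mulr1.
  case: v => [|j v].
    by rewrite meixner_poly0 mulr1 [xword _ _](meixner_poly1 C T) phiP mul0r.
  rewrite meixner_poly_rec scalar_combE !phiP big1 => [|k _]; last first.
    by rewrite phiP mulr0.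
  rewrite !add0r eqseq_cons mulr1 -mulnb natrM.
  by case: v => [|a v] /=; rewrite ?mulr1 // !mulr0.
rewrite gram_meixner_cons (IH w) //; last by rewrite ltnW.
under [in X in _ - X - _]eq_bigr => k _ do rewrite (IH (k :: w)) //.
case: v => [|l v].
  rewrite meixner_poly0 mulr1 [xword _ _](meixner_poly1 C T) (IH (j :: w)) //.
  rewrite big1 => [|k _]; last by rewrite mul0r mulr0.
  rewrite subr0 mul0r /= eqseq_cons.
  have [->|_] := eqVneq j i; last by rewrite !mul0r subrr.
  case: (w) => [|a w'] /=; rewrite ?eqxx ?mul1r ?mulr1 ?subrr //.
  by rewrite !mul0r mulr0 subrr.
rewrite meixner_poly_rec gram_combr !(IH (j :: w)) //.
rewrite (eq_bigr (fun k => T i k l *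
    (((j == k) && (w == v))%:R * sqnorm (j :: w)))) => [|k _]; last first.
  by rewrite (IH (j :: w)) // eqseq_cons.
rewrite (sum_pick j (fun k => T i k l) (w == v) (fun=> sqnorm (j :: w))).
rewrite [X in _ - X - _](eq_bigr (fun k => T i j k *
    (((l == k) && (w == v))%:R * sqnorm (k :: w)))) => [|k _]; last first.
  by rewrite eqseq_cons [k == l]eq_sym.
rewrite (sum_pick l (fun k => T i j k) (w == v) (fun k => sqnorm (k :: w))).
have -> : T i j l * ((w == v)%:R * sqnorm (j :: w)) =
    T i j l * ((w == v)%:R * sqnorm (l :: w)).
  by rewrite [LHS]mulrCA [RHS]mulrCA (sqnorm_comm i j l w).
rewrite !eqseq_cons [j == i]eq_sym.
have -> : (i == l)%:R * meixner_weight C i v *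
      ((j :: w == v)%:R * sqnorm (j :: w)) =
    ((i == l) && (j :: w == v))%:R * sqnorm [:: i, j & w].
  rewrite -mulnb natrM; have [<-|_] := eqVneq (j :: w) v; last first.
    by rewrite !(mul0r, mulr0).
  by rewrite mulr1 mul1r -mulrA.
have [->|_] := eqVneq i j; last by rewrite !mul0r; ring.
by rewrite /=; case: (w == l :: v); rewrite ?mul1r ?mul0r ?mulr0; ring.
Qed.

Lemma free_meixner_is_state : is_state phi.
Proof.
have [phi1 _] := (free_meixner_functionalP C T phi).2 (fun=> erefl).
have sq0 u : 0 <= sqnorm u.
  by elim: u => [|i u IH] /=; rewrite ?ler01 // mulr_ge0 // meixner_weight_ge0.
split=> // p; rewrite -/(gram phi p p).
have [rep [fb [_ fbE fbK]]] := meixner_basis C T.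
have -> : p = \sum_(m <- msupp (rep p)) (rep p)@_m *: P m.
  by rewrite -{1}(fbK p) (linear_wordE fb); apply: eq_bigr => m _; rewrite fbE.
rewrite gram_suml big_seq sumr_ge0 // => m mp; rewrite gram_sumr.
rewrite (bigD1_seq m) ?fset_uniq //= big1 => [|m' m'm]; last first.
  rewrite meixner_orthogonal eq_sym (negPf (m'm : val m' != val m)).
  by rewrite mul0r mulr0.
rewrite addr0 meixner_orthogonal eqxx mul1r mulrA mulr_ge0 //.
by rewrite mulrC mul_conjC_ge0.
Qed.

End Data.
End Positivity.

(** * The bijection on the Meixner class *)

Section Shift.
Local Open Scope sesquilinear_scope.
Variables (K : numClosedFieldType) (d : nat).
Variables (C : 'M[K]_(d * d)) (T : 'I_d -> 'M[K]_d).

Lemma meixner_data_add1 : meixner_data C T -> meixner_data (1%:M + C) T.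
Proof.
case=> hT dC [hC pC] cC; split=> //.
- apply/is_diag_mxP => i j ij; rewrite !mxE (is_diag_mxP dC) // -val_eqE /=.
  by rewrite (negPf ij) addr0.
- split.
    apply/is_hermitianmxP; have /is_hermitianmxP := hC.
    rewrite !expr0 !scale1r; move: (1%:M + C) => B e.
    rewrite [(1%:M + B)^T]linearD /= map_mxD -e.
    by rewrite tr_scalar_mx map_scalar_mx rmorph1.
  move=> v; rewrite mulmxDr mulmxDl mulmx1 mxE addr_ge0 //.
  by rewrite mxE sumr_ge0 // => i _; rewrite !mxE mulrC mul_conjC_ge0.
by move=> i; rewrite mulmxDr mulmxDl mulmx1 mul1mx cC.
Qed.

(** Both cumulant series are k, the series with D_i k = paths T w [:: i]. *)
Lemma boolean_to_free_meixner (phi : {scalar ncpoly K d}) :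
  phi =1 free_meixner_functional C T ->
  boolean_to_free phi =1 free_meixner_functional (1%:M + C) T.
Proof.
move=> phiE p; apply/esym; move: p; apply/boolean_to_freeP.
pose w j i := 1 + diag_entry C j i.
pose k : ncseries K 'I_d :=
  fun u => if u is i :: v then paths T w [:: i] v else 0.
pose m : ncseries K 'I_d := fun u => phi (xword K u).
pose M : ncseries K 'I_d :=
  fun u => free_meixner_functional (1%:M + C) T (xword K u).
have [m0 Dm] := @meixner_moments K d C T m (fun u => phiE _).
have [M0 DM] := @meixner_moments K d (1%:M + C) T M (fun u => erefl).
have w1 : (fun j i => 1 + diag_entry (1%:M + C) j i) = (fun j i => 1 + w j i).
  by apply/funext => j; apply/funext => i; rewrite /w /diag_entry !mxE eqxx.
rewrite w1 in DM.
split=> [|u u0]; first by rewrite -xword0.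
rewrite -(@boolean_cumulant_eq _ _ phi m k m0 (fun=> erefl) Dm) //.
apply: (@free_cumulant_eq _ _ _ M k M0 (fun=> erefl)) => // i.
by rewrite DM -(ssubst_paths M0 DM).
Qed.

End Shift.

Theorem mainTheorem9 (R : realType) (d : nat) :
  (forall phi : {scalar ncpoly R[i] d},
     free_meixner_state phi -> free_meixner_state (boolean_to_free phi)) /\
  (forall (C : 'M[R[i]]_(d * d)) (T : 'I_d -> 'M[R[i]]_d),
     meixner_data C T ->
     meixner_data (1%:M + C) T /\
     boolean_to_free (free_meixner_functional C T)
       =1 free_meixner_functional (1%:M + C) T).
Proof.
split=> [phi [_ [C [T [CT phiE]]]]|C T CT].
  have CT1 := meixner_data_add1 CT; have e := boolean_to_free_meixner phiE.
  split; last by exists (1%:M + C), T.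
  have [s1 s2] := free_meixner_is_state CT1.
  by split=> [|p]; rewrite e.
by split; [apply: meixner_data_add1|apply: boolean_to_free_meixner].
Qed.
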